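(* Let $\lambda\in(0,1)$. Then for any smooth radial solution $\vec u(t)=(u,u_t)$, defined for $t\in[0,1)$, to $$u_{tt}-u_{rr}-\tfrac{3}{r}u_r-u^3=0$$ such that $$\sup_{t\in[0,1)}\|\vec u(t)\|_{\mathcal{H}}<\infty,$$ we have $$\lim_{t\nearrow1}\int_{\lambda(1-t)}^{1-t}\left[u_t^2(t,r)+u_r^2(t,r)+\frac{u^2(t,r)}{r^2}\right]r^3\,dr=0 .$$
   Context: All functions of $x\in\mathbb{R}^4$ are real-valued and radial, written $f(x)=f(r)$, $r=|x|$. $\mathcal{H}=\dot H^1\times L^2(\mathbb{R}^4)$ (radial), with $\|(f,g)\|_{\mathcal{H}}^2=\int_0^\infty(f_r^2+g^2)\,r^3dr$ (dimensional constants are dropped). For every data in $\mathcal{H}$ the equation has a unique solution $\vec u=(u,u_t)\in C(I_{\max};\mathcal{H})$ with $u\in L^3_t(J;L^6_x(\mathbb{R}^4))$ for every compact $J\subset I_{\max}$, on a maximal interval $I_{\max}=(T_-(\vec u),T_+(\vec u))$. *)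

(* Defs.v *)
From HB Require Import structures.
From mathcomp Require Import all_boot all_order all_algebra.
From mathcomp Require Import all_classical all_reals all_analysis.

Set Implicit Arguments.
Unset Strict Implicit.
Unset Printing Implicit Defensive.

Import Order.TTheory GRing.Theory Num.Theory.
Import numFieldNormedType.Exports.

Local Open Scope classical_set_scope.
Local Open Scope ring_scope.

(* The library norm on 'rV_n is the max norm; the radial variable |x| is the
   Euclidean one. *)
Definition euclid (R : realType) (n : nat) (x : 'rV[R]_n) : R :=
  Num.sqrt (\sum_(i < n) x 0 i ^+ 2).

Fixpoint Ck_on (R : realType) (V : normedModType R) (k : nat) (O : set V)
    (f : V -> R) : Prop :=
  {in O, continuous f} /\
  (if k is k'.+1 then
     forall v : V, (forall x, O x -> derivable f x v) /\ Ck_on k' O ('D_v f)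
   else True).

(* On a set A that need not be open, smooth means smooth in some open
   neighbourhood of A. For functions smooth up to the boundary only, f stands
   for a chosen extension; its values off that neighbourhood are irrelevant. *)
Definition smooth_on (R : realType) (V : normedModType R) (A : set V)
    (f : V -> R) : Prop :=
  exists O : set V, [/\ open O, A `<=` O & forall k, Ck_on k O f].

(* A radial function f on R^4 is given by its profile r |-> f r; only the
   values at r >= 0 are meaningful. A radial function on spacetime is
   u : R -> R -> R, with u t r its value at time t and radius r. *)
Definition spacetime_lift (R : realType) (u : R -> R -> R) :
    R * 'rV[R]_4 -> R :=
  fun p => u p.1 (euclid p.2).

Definition dt (R : realType) (u : R -> R -> R) (t r : R) : R :=
  derive1 (u ^~ r) t.

Definition dtt (R : realType) (u : R -> R -> R) (t r : R) : R :=
  derive1n 2 (u ^~ r) t.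

Definition dr (R : realType) (u : R -> R -> R) (t r : R) : R :=
  derive1 (u t) r.

Definition drr (R : realType) (u : R -> R -> R) (t r : R) : R :=
  derive1n 2 (u t) r.

(* Integral over R^4 of a radial function, without the area of S^3. *)
Definition radial_int (R : realType) (f : R -> R) : \bar R :=
  (\int[@lebesgue_measure R]_(r in `]0%R, +oo[) (f r * r ^+ 3)%:E)%E.

Definition H_norm (R : realType) (f g : R -> R) : \bar R :=
  poweR (radial_int (fun r => derive1 f r ^+ 2 + g r ^+ 2)) 2^-1.

(* Membership of (f, g) in H = \dot H^1 x L^2, for f and g smooth. As usual
   \dot H^1(R^4) = {f in L^4 : grad f in L^2}, so that nonzero constants are
   excluded. *)
Definition in_H (R : realType) (f g : R -> R) : Prop :=
  (H_norm f g < +oo)%E /\ (radial_int (fun r => f r ^+ 4)%R < +oo)%E.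

(* (u, u_t) is a smooth radial solution on the time interval J: it is smooth on
   J x R^4, belongs to C(J; H) and to L^3(K; L^6) for K compact in J, and solves
   the equation pointwise. (||f||_{L^6}^3 = (\int f^6)^(1/2).) *)
Definition smooth_radial_solution (R : realType) (J : set R)
    (u : R -> R -> R) : Prop :=
  [/\ smooth_on (J `*` [set: 'rV[R]_4]) (spacetime_lift u),
      forall t, J t -> in_H (u t) (dt u t),
      forall t0, J t0 ->
        H_norm (fun r => u t r - u t0 r) (fun r => dt u t r - dt u t0 r)
          @[t --> within J (nbhs t0)] --> 0%E,
      forall K : set R, compact K -> K `<=` J ->
        (\int[@lebesgue_measure R]_(t in K)
           poweR (radial_int (fun r => u t r ^+ 6)%R) 2^-1%R < +oo)%E &
      forall t r, J t -> 0 < r ->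
        dtt u t r - drr u t r - 3 / r * dr u t r - u t r ^+ 3 = 0].

(* Main.v *)
(* In the characteristic coordinates x = 1 - t - r, y = 1 - t + r, the function
   V = r^(3/2) u satisfies V_xy = (r^(3/2) u^3 - (3/4) u / r^(1/2)) / 4. Bounded
   energy makes r u bounded, so |V_xy| <= C |V| / (y - x)^2 and
   |V| <= C (y - x)^(1/2); nothing else about the nonlinearity matters.

   Outside the cone, x <= 0, integrate back to a slice t < 1. In the ratio x / y
   the bound on V_xy is integrable uniformly in scale, so a weight exp (al x / y)
   absorbs it and V at (x, y) is controlled by the energy of the slice within
   radius about y. A Hardy inequality then bounds the flux, the integral of
   V_y(0, y)^2, up to the tip of the cone. Hence the flux near the tip is small
   and V(0, y) = o(y^(1/2)).

   Inside the cone the same absorption, started from the cone and from a line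
   y = y1 on which V_x is bounded, gives V = o(y^(1/2)) in the sector x <= k y.
   Integrating V_xy once more yields V_x = o(y^(-1/2)) up to bounded terms and
   V_y = V_y(0, y) + o(y^(-1/2)), so the energy of the sector on a slice tends
   to 0.

   Integrals of the solution are replaced throughout by the comparison
   |f'| <= F' ==> |f b - f a| <= F b - F a. *)

Require Import Defs.
From HB Require Import structures.
From mathcomp Require Import all_boot all_order all_algebra.
From mathcomp Require Import all_classical all_reals all_analysis.
From mathcomp Require Import measurable_realfun ring lra.

Set Implicit Arguments.
Unset Strict Implicit.
Unset Printing Implicit Defensive.

Import Order.TTheory GRing.Theory Num.Theory.
Import numFieldNormedType.Exports.

Local Open Scope classical_set_scope.
Local Open Scope ring_scope.

(** * Calculus on the real line *)

Section Calculus.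
Context {R : realType}.
Implicit Types (f g F : R -> R) (x a b : R).

(** The potential in [V_xy] is scale invariant and [C] is not small, so iterating the bound on
    [V_xy] gains nothing by itself; the exponential weights gain the missing small factor for every
    [C]. The flux estimate runs backwards in time, from the slice [t = 1 - T] to the earlier part of
    the cone. The characteristic triangle between them has [r >= y / 2], hence stays off the axis,
    and its constants must not depend on [T], since [T] tends to 0. The slice enters through the
    weighted energy [S], the integral of [(V_x^2 + V_y^2) r^(1/2)]. With the plain energy [H],
    Cauchy-Schwarz gives [|V| <= c (H r)^(1/2)], and [V_xy] contributes [H / y] to [V_y(0, y)^2]:
    the flux bound diverges logarithmically. With [S] one gets [|V| <= c S^(1/2) r^(1/4)] and the
    contribution [S / y^(3/2)], whose integral is bounded by the energy after exchanging the two
    integrations. Any exponent strictly between 0 and 1 has this effect; 1/2 is the one that leads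
    to fourth roots. *)

Lemma deriv_eq f x a b : is_derive x 1 f a -> a = b -> is_derive x 1 f b.
Proof. by move=> fa <-. Qed.

Lemma derivC (c x : R) : is_derive x 1 (fun=> c) 0.
Proof. exact: is_derive_cst. Qed.

Lemma derivI x : is_derive x 1 (fun z => z) 1.
Proof. exact: is_derive_id. Qed.

Lemma derivD f g x a b : is_derive x 1 f a -> is_derive x 1 g b ->
  is_derive x 1 (fun z => f z + g z) (a + b).
Proof. by move=> fa gb; apply: is_deriveD. Qed.

Lemma derivB f g x a b : is_derive x 1 f a -> is_derive x 1 g b ->
  is_derive x 1 (fun z => f z - g z) (a - b).
Proof. by move=> fa gb; apply: is_deriveB. Qed.

Lemma derivM f g x a b : is_derive x 1 f a -> is_derive x 1 g b ->
  is_derive x 1 (fun z => f z * g z) (a * g x + f x * b).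
Proof.
move=> fa gb; apply: deriv_eq (is_deriveM fa gb) _.
by rewrite addrC /GRing.scale /= mulrC.
Qed.

Lemma derivX f x a n : is_derive x 1 f a ->
  is_derive x 1 (fun z => f z ^+ n.+1) (n.+1%:R * f x ^+ n * a).
Proof.
move=> fa.
have H : is_derive x 1 (f ^+ n.+1) ((n.+1%:R * f x ^+ n) *: a) by exact: is_deriveX.
by rewrite exprfctE in H.
Qed.

Lemma derivV f x a : f x != 0 -> is_derive x 1 f a ->
  is_derive x 1 (fun z => (f z)^-1) (- a / f x ^+ 2).
Proof.
move=> fx0 [fd fa]; split; first exact: derivableV.
by rewrite deriveV// fa /GRing.scale/= !mulNr mulrC.
Qed.

Lemma deriv_comp f g x a b : is_derive (g x) 1 f a -> is_derive x 1 g b ->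
  is_derive x 1 (fun z => f (g z)) (a * b).
Proof.
move=> fa gb; have := @is_derive1_comp _ f g x a b fa gb.
by rewrite /GRing.scale /=.
Qed.

Lemma deriv_expR f x a : is_derive x 1 f a ->
  is_derive x 1 (fun z => expR (f z)) (expR (f x) * a).
Proof. exact: deriv_comp. Qed.

Lemma deriv_sqrt f x a : 0 < f x -> is_derive x 1 f a ->
  is_derive x 1 (fun z => Num.sqrt (f z)) (a / (2 * Num.sqrt (f x))).
Proof.
move=> fx fa; rewrite mulrC.
by apply: (@deriv_comp Num.sqrt) fa; exact: is_derive1_sqrt.
Qed.

Lemma deriv_cts f x a : is_derive x 1 f a -> {for x, continuous f}.
Proof. by case=> /derivable1_diffP/differentiable_continuous. Qed.

Lemma ndecr_of_deriv F dF a b : a <= b ->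
  (forall x, a <= x <= b -> is_derive x 1 F (dF x)) ->
  (forall x, a <= x <= b -> 0 <= dF x) -> F a <= F b.
Proof.
move=> ab HF H0.
have [||c cab E] := @MVT_segment R F dF a b ab.
- by move=> x; rewrite in_itv /= => /andP[ax xb]; apply: HF; rewrite !ltW.
- apply: derivable_within_continuous => x; rewrite in_itv /= => xab.
  by case: (HF x xab).
by rewrite -subr_ge0 E mulr_ge0 ?subr_ge0// H0.
Qed.

Lemma deriv_comparison f F df dF a b : a <= b ->
  (forall x, a <= x <= b -> is_derive x 1 f (df x)) ->
  (forall x, a <= x <= b -> is_derive x 1 F (dF x)) ->
  (forall x, a <= x <= b -> `|df x| <= dF x) -> `|f b - f a| <= F b - F a.
Proof.
move=> ab Hf HF H.
have H1 : F a - f a <= F b - f b.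
  apply: (@ndecr_of_deriv (fun x => F x - f x) (fun x => dF x - df x)) => // x xab.
    by apply: derivB; [exact: HF | exact: Hf].
  by have := H x xab; rewrite ler_norml => /andP[]; lra.
have H2 : F a + f a <= F b + f b.
  apply: (@ndecr_of_deriv (fun x => F x + f x) (fun x => dF x + df x)) => // x xab.
    by apply: derivD; [exact: HF | exact: Hf].
  by have := H x xab; rewrite ler_norml => /andP[]; lra.
by rewrite ler_norml; lra.
Qed.

Lemma primitive_unique F G f a b : a <= b ->
  (forall x, a <= x <= b -> is_derive x 1 F (f x)) ->
  (forall x, a <= x <= b -> is_derive x 1 G (f x)) -> F b - F a = G b - G a.
Proof.
move=> ab HF HG.
have : `|F b - G b - (F a - G a)| <= 0 - 0.
  apply: (@deriv_comparison (fun x => F x - G x) (fun=> 0) (fun=> 0) (fun=> 0)) => // x xab.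
  - by rewrite -(subrr (f x)); apply: derivB; [exact: HF | exact: HG].
  - by rewrite normr0.
by rewrite subrr normr_le0 => /eqP; lra.
Qed.

(** The least admissible [m] satisfies [m <= B + m / 2]. The bound [m0] makes this supremum finite;
    its size does not reach the conclusion. *)
Lemma absorb_half (T : Type) (D : T -> Prop) (f : T -> R) (B m0 : R) :
  (forall p, D p -> f p <= m0) ->
  (forall m, (forall p, D p -> f p <= m) -> forall p, D p -> f p <= B + m / 2) ->
  forall p, D p -> f p <= 2 * B.
Proof.
move=> H0 H p Dp.
pose A := [set f q | q in D].
have Aub : ubound A (sup A).
  apply: sup_upper_bound; split; first by exists (f p), p.
  by exists m0 => _ [q Dq <-]; exact: H0.
have Hs q : D q -> f q <= B + sup A / 2.
  by apply: H => r Dr; apply: Aub; exists r.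
have : sup A <= B + sup A / 2.
  by apply: ge_sup; [exists (f p), p | move=> _ [q Dq <-]; exact: Hs].
by have := Hs _ Dp; lra.
Qed.

Lemma sqr_le_of_norm (x y : R) : `|x| <= y -> x ^+ 2 <= y ^+ 2.
Proof.
move=> xy; rewrite -[in leLHS]real_normK ?num_real//.
by rewrite ler_pXn2r ?nnegrE//; exact: le_trans xy.
Qed.

Lemma sqr_add_le (x y : R) : (x + y) ^+ 2 <= 2 * x ^+ 2 + 2 * y ^+ 2.
Proof. by have := sqr_ge0 (x - y); rewrite sqrrB sqrrD !mulr2n; lra. Qed.

Lemma young_abs (m s x : R) : 0 < m -> 0 < s ->
  `|x| <= (m * (x ^+ 2 * s) + (m * s)^-1) / 2.
Proof.
move=> m0 s0; have ms : 0 < m * s by rewrite mulr_gt0.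
suff : 0 <= (m * s)^-1 * (m * s * `|x| - 1) ^+ 2.
  have -> : (m * s)^-1 * (m * s * `|x| - 1) ^+ 2
          = m * (`|x| ^+ 2 * s) + (m * s)^-1 - 2 * `|x|.
    by field; rewrite !gt_eqF.
  by rewrite real_normK ?num_real//; lra.
by rewrite mulr_ge0 ?invr_ge0 ?sqr_ge0 ?ltW.
Qed.

(** Derivatives are two-sided, so they are claimed on the open interval only. For a comparison on a
    closed interval the primitive is taken on a larger one, whence endpoints such as [T / 2],
    [3 / 2] and [r2 + 1] below. *)
Lemma primitive_exists f (a b : R) : a < b ->
  (forall x, a <= x <= b -> {for x, continuous f}) ->
  exists F, F a = 0 /\ forall x, a < x < b -> is_derive x 1 F (f x).
Proof.
move=> ab cf.
have fi : (@lebesgue_measure R).-integrable `[a, b] (EFin \o f).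
  apply: continuous_compact_integrable; first exact: segment_compact.
  apply: continuous_in_subspaceT => x; rewrite inE/= in_itv/= => xab; exact: cf.
exists (fun x => \int[@lebesgue_measure R]_(t in `[a, x]) (f t))%R; split.
  by rewrite set_itv1 Rintegral_set1.
move=> x /andP[ax xb].
have [] := @continuous_FTC1_closed R f a x b xb fi ax.
  by apply: cf; rewrite !ltW.
by rewrite derive1E => H1 H2; split.
Qed.

Lemma integral_primitive f F (a b : R) : a < b ->
  (forall x, a <= x <= b -> {for x, continuous f}) ->
  (forall x, a <= x <= b -> is_derive x 1 F (f x)) ->
  (\int[@lebesgue_measure R]_(x in `[a, b]) (f x)%:E = (F b - F a)%:E)%E.
Proof.
move=> ab cf dF; rewrite (@continuous_FTC2 R f F a b)//.
- apply: continuous_in_subspaceT => x; rewrite inE/= in_itv/= => xab; exact: cf.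
- split.
  + by move=> x; rewrite in_itv/= => /andP[ax xb]; case: (dF x _) => //; rewrite !ltW.
  + have /deriv_cts : is_derive a 1 F (f a) by apply: dF; rewrite lexx ltW.
    by move=> /cvg_at_right_filter.
  + have /deriv_cts : is_derive b 1 F (f b) by apply: dF; rewrite lexx ltW.
    by move=> /cvg_at_left_filter.
- move=> x; rewrite in_itv/= => /andP[ax xb].
  by rewrite derive1E; case: (dF x _) => //; rewrite !ltW.
Qed.

End Calculus.

Ltac nonaffine P :=
  match P with
  | context [Num.norm _] => idtac
  | context [Num.sqrt _] => idtac
  | context [expR _] => idtac
  | context [_ ^+ _] => idtac
  end.

Ltac clear_nonaffine :=
  repeat match goal with
  | H : is_true (_ <= _) |- _ =>
      let P := type of H in nonaffine P; clear H
  | H : is_true (_ < _) |- _ =>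
      let P := type of H in nonaffine P; clear H
  | H : ?P |- _ =>
      lazymatch P with
      | is_true (_ <= _) => fail
      | is_true (_ < _) => fail
      | _ => lazymatch type of P with Prop => clear H end
      end
  end.

(** For an affine goal the hypotheses with norms, roots, exponentials or powers are first dropped;
    they come back only if that attempt fails. *)
Ltac lra_context :=
  lazymatch goal with
  | |- is_true (_ && _) => apply/andP; split; lra_context
  | |- ?G => tryif nonaffine G then lra else first [clear_nonaffine; lra | lra]
  end.

(** * The equation in characteristic coordinates *)

(* [V x y] stands for [r^(3/2) u(t, r)] with [x = 1 - t - r], [y = 1 - t + r];
   [a], [b], [g] are [V_x], [V_y], [V_xy]. In [cw_Vr] and [cw_E] the variable
   [t] is the distance to the blow-up time: the slice is [x + y = 2 t]. *)
Record char_wave {R : realType} (C : R) (V a b g : R -> R -> R) : Prop :=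
  CharWave {
  cw_C : 0 < C;
  cw_Vx : forall x y : R, x < y -> 0 < x + y < 2 ->
    is_derive x 1 (V ^~ y) (a x y);
  cw_Vy : forall x y : R, x < y -> 0 < x + y < 2 -> is_derive y 1 (V x) (b x y);
  cw_Vr : forall t r : R, 0 < t < 1 -> 0 < r ->
    is_derive r 1 (fun r => V (t - r) (t + r)) (b (t - r) (t + r) - a (t - r) (t + r));
  cw_ay : forall x y : R, x < y -> 0 < x + y < 2 -> is_derive y 1 (a x) (g x y);
  cw_bx : forall x y : R, x < y -> 0 < x + y < 2 -> is_derive x 1 (b ^~ y) (g x y);
  cw_g : forall x y : R, x < y -> 0 < x + y < 2 ->
    `|g x y| <= C * `|V x y| / (y - x) ^+ 2;
  cw_V : forall x y : R, x < y -> 0 < x + y < 2 -> `|V x y| <= C * Num.sqrt (y - x);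
  cw_ca : forall x y : R, x < y -> 0 < x + y < 2 ->
    {for (x, y), continuous (fun p : R * R => a p.1 p.2)};
  cw_cb : forall x y : R, x < y -> 0 < x + y < 2 ->
    {for (x, y), continuous (fun p : R * R => b p.1 p.2)};
  cw_E : forall (t r1 r2 : R) (H : R -> R), 0 < t < 1 -> 0 < r1 -> r1 <= r2 ->
    (forall r, r1 <= r <= r2 ->
      is_derive r 1 H (a (t - r) (t + r) ^+ 2 + b (t - r) (t + r) ^+ 2)) ->
    H r2 - H r1 <= C }.

(** * Fourth roots, and continuity along slices *)

Section Quartic.
Context {R : realType}.
Implicit Types x y : R.

(** The growth rate of [V] along a slice: Cauchy-Schwarz against the weight [r^(1/2)] leaves the
    square root of the integral of [r^(-1/2)], a multiple of [r^(1/4)]. *)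
Definition root4 x : R := Num.sqrt (Num.sqrt x).

Lemma root4_gt0 x : 0 < x -> 0 < root4 x.
Proof. by move=> x0; rewrite !sqrtr_gt0. Qed.

Lemma root4_ge0 x : 0 <= root4 x.
Proof. exact: sqrtr_ge0. Qed.

Lemma root4_le x y : x <= y -> root4 x <= root4 y.
Proof. by move=> xy; rewrite !ler_wsqrtr. Qed.

Lemma root4_sq x : root4 x ^+ 2 = Num.sqrt x.
Proof. by rewrite sqr_sqrtr// sqrtr_ge0. Qed.

Lemma deriv_root4 x : 0 < x -> is_derive x 1 root4 (root4 x / (4 * x)).
Proof.
move=> x0; have s0 : 0 < Num.sqrt x by rewrite sqrtr_gt0.
refine (deriv_eq (deriv_sqrt s0 (deriv_sqrt x0 (derivI x))) _).
have Es : Num.sqrt x = root4 x ^+ 2 by rewrite root4_sq.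
have Ex : x = root4 x ^+ 4 by rewrite (exprM _ 2 2) -Es sqr_sqrtr// ltW.
have aux (q s z : R) : 0 < q -> s = q ^+ 2 -> z = q ^+ 4 ->
    1 / (2 * s) / (2 * q) = q / (4 * z).
  by move=> q0 -> ->; field; rewrite gt_eqF.
by apply: aux => //; exact: root4_gt0.
Qed.

End Quartic.

Section Slices.
Context {R : realType} {C : R} {V a b g : R -> R -> R} (cw : char_wave C V a b g).

Lemma continuous_along (f : R -> R -> R) (al be : R -> R) (r : R) :
  {for r, continuous al} -> {for r, continuous be} ->
  {for (al r, be r), continuous (fun p : R * R => f p.1 p.2)} ->
  {for r, continuous (fun r => f (al r) (be r))}.
Proof.
move=> ca cb cf.
have c1 : {for r, continuous (fun s : R => (al s, be s))} by exact: (cvg_pair ca cb).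
exact: (continuous_comp c1 cf).
Qed.

Lemma slice_domain (t r : R) : 0 < t < 1 -> 0 < r ->
  t - r < t + r /\ 0 < (t - r) + (t + r) < 2.
Proof. by move=> /andP[t0 t1] r0; split; [lra|apply/andP; split; lra]. Qed.

Lemma slice_density_continuous (t r : R) : 0 < t < 1 -> 0 < r ->
  {for r, continuous (fun r => a (t - r) (t + r) ^+ 2 + b (t - r) (t + r) ^+ 2)}.
Proof.
move=> t01 r0; have [d1 d2] := slice_domain t01 r0.
have cm : {for r, continuous (fun r => t - r)}.
  by apply: cvgB; [exact: cvg_cst | exact: cvg_id].
have cp : {for r, continuous (fun r => t + r)}.
  by apply: cvgD; [exact: cvg_cst | exact: cvg_id].
have ca := continuous_along cm cp (cw_ca cw d1 d2).
have cb := continuous_along cm cp (cw_cb cw d1 d2).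
apply: cvgD; [exact: (cvgM ca ca) | exact: (cvgM cb cb)].
Qed.

End Slices.

(** * The exterior of the cone *)

Section Exterior.
Context {R : realType} {C : R} {V a b g : R -> R -> R} (cw : char_wave C V a b g).
Context {T : R} (T0 : 0 < T) (T1 : 2 * T <= 1).
Context {S : R -> R}.

Let h2 (r : R) := a (T - r) (T + r) ^+ 2 + b (T - r) (T + r) ^+ 2.

Context (dS : forall r : R, T <= r <= 1 -> is_derive r 1 S (h2 r * Num.sqrt r)).
(* The initial value of [S] accounts for [V] at the inner end [r = T] of the
   slice. *)
Context (ST : S T = Num.sqrt T).

Let C0 : 0 < C.
Proof. exact: (cw_C cw). Qed.

Let h2_ge0 r : 0 <= h2 r.
Proof. by rewrite addr_ge0// sqr_ge0. Qed.

Lemma weighted_energy_mono (r s : R) : T <= r -> r <= s -> s <= 1 -> S r <= S s.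
Proof.
move: T0 T1 C0 => tpos tle cpos.
move=> Tr rs s1; apply: (@ndecr_of_deriv R S (fun r => h2 r * Num.sqrt r)) => //.
  by move=> x /andP[rx xs]; apply: dS; apply/andP; split; [exact: le_trans rx | exact: le_trans s1].
by move=> x _; rewrite mulr_ge0// sqrtr_ge0.
Qed.

(* AM-GM, [|a| <= (m a^2 s^(1/2) + 1 / (m s^(1/2))) / 2], with [m] optimal at
   the endpoint [r]. *)
Lemma slice_majorant (r N : R) : T <= r <= 1 -> 0 < N -> S r <= N ^+ 2 ->
  exists A dA : R -> R, A r <= 2 * N * root4 r /\
   forall s, T <= s <= r -> [/\ 0 <= A s, is_derive s 1 A (dA s),
     `|a (T - s) (T + s)| <= dA s & `|b (T - s) (T + s)| <= dA s].
Proof.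
move: T0 T1 C0 => tpos tle cpos.
move=> /andP[Tr r1] N0 SN.
have q0 : 0 < root4 r by apply: root4_gt0; lra_context.
pose m := root4 r / N; have m0 : 0 < m by rewrite divr_gt0.
exists (fun s => (m * S s + 2 * Num.sqrt s / m) / 2).
exists (fun s => (m * (h2 s * Num.sqrt s) + (m * Num.sqrt s)^-1) / 2); split.
  rewrite -root4_sq.
  have -> : 2 * root4 r ^+ 2 / m = 2 * N * root4 r.
    by rewrite /m; field; rewrite !gt_eqF.
  have : m * S r <= m * N ^+ 2 by rewrite ler_wpM2l// ltW.
  have -> : m * N ^+ 2 = N * root4 r by rewrite /m; field; rewrite gt_eqF.
  have : 0 <= N * root4 r by rewrite mulr_ge0// ltW.
  by lra_context.
move=> s /andP[Ts sr].
have s0 : 0 < s by lra_context.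
have ss0 : 0 < Num.sqrt s by rewrite sqrtr_gt0.
have h2a : h2 s * Num.sqrt s >= a (T - s) (T + s) ^+ 2 * Num.sqrt s.
  by rewrite ler_wpM2r ?sqrtr_ge0// /h2 lerDl sqr_ge0.
have h2b : h2 s * Num.sqrt s >= b (T - s) (T + s) ^+ 2 * Num.sqrt s.
  by rewrite ler_wpM2r ?sqrtr_ge0// /h2 lerDr sqr_ge0.
split.
- rewrite divr_ge0// addr_ge0//.
    rewrite mulr_ge0 ?(ltW m0)//.
    by apply: le_trans (weighted_energy_mono (lexx T) Ts _); [rewrite ST sqrtr_ge0 | lra_context].
  by rewrite divr_ge0 ?(ltW m0)// mulr_ge0 ?sqrtr_ge0.
- have dSs : is_derive s 1 S (h2 s * Num.sqrt s) by apply: dS; lra_context.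
  refine (deriv_eq (derivM (derivD (derivM (derivC m s) dSs)
    (derivM (derivM (derivC 2 s) (deriv_sqrt s0 (derivI s))) (derivC m^-1 s))) (derivC 2^-1 s)) _).
  by field; rewrite !gt_eqF.
- apply: le_trans (young_abs _ m0 ss0) _.
  by rewrite ler_wpM2r// lerD2r ler_wpM2l// ltW.
- apply: le_trans (young_abs _ m0 ss0) _.
  by rewrite ler_wpM2r// lerD2r ler_wpM2l// ltW.
Qed.

(** Integrate [V_r = b - a] from the inner end [r = T], which lies on the cone. There
    [|V| <= C (2 T)^(1/2)], and [T^(1/2) = S T <= N^2] turns this into a multiple of [N T^(1/4)]. *)
Lemma slice_bound (r N : R) : T <= r <= 1 -> 0 < N -> S r <= N ^+ 2 ->
  `|V (T - r) (T + r)| <= (2 * C + 4) * N * root4 r.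
Proof.
move: T0 T1 C0 => tpos tle cpos.
move=> /andP[Tr r1] N0 SN.
have Trr : T <= r <= 1 by rewrite Tr.
have [A [dA [Ar HA]]] := slice_majorant Trr N0 SN.
have T01 : 0 < T < 1 by rewrite T0/=; lra_context.
have : `|V (T - r) (T + r) - V (T - T) (T + T)| <= 2 * A r - 2 * A T.
  apply: (@deriv_comparison R (fun r => V (T - r) (T + r)) (fun r => 2 * A r)
    (fun r => b (T - r) (T + r) - a (T - r) (T + r)) (fun r => 2 * dA r)) => // s /[dup] sr /andP[Ts _].
  - by apply: (cw_Vr cw) => //; lra_context.
  - have [_ dAs _ _] := HA s sr.
    by refine (deriv_eq (derivM (derivC 2 s) dAs) _); ring.
  - have [_ _ ha hb] := HA s sr.
    by apply: le_trans (ler_normB _ _) _; lra_context.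
have [AT _ _ _] : [/\ 0 <= A T, is_derive T 1 A (dA T), 
   `|a (T - T) (T + T)| <= dA T & `|b (T - T) (T + T)| <= dA T].
  by apply: HA; rewrite lexx.
have VT : `|V (T - T) (T + T)| <= 2 * C * N * root4 r.
  have [d1 d2] := slice_domain T01 T0.
  apply: le_trans (cw_V cw d1 d2) _.
  have -> : T + T - (T - T) = 2 * T by ring.
  have q1 : root4 T <= N.
    rewrite -(@ler_pXn2r _ 2) ?nnegrE ?root4_ge0 ?(ltW N0)//.
    by rewrite root4_sq -ST (le_trans _ SN)// weighted_energy_mono.
  have s2 : Num.sqrt (2 * T) <= 2 * Num.sqrt T.
    rewrite -(@ler_pXn2r _ 2) ?nnegrE ?mulr_ge0 ?sqrtr_ge0//.
    by rewrite exprMn !sqr_sqrtr; lra_context.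
  have : root4 T ^+ 2 <= N * root4 r.
    by rewrite expr2 ler_pM ?root4_ge0// root4_le.
  rewrite root4_sq => s3.
  have : Num.sqrt (2 * T) <= 2 * (N * root4 r) by lra_context.
  by rewrite -(ler_pM2l C0); lra_context.
move=> Hd.
have := ler_normD (V (T - r) (T + r) - V (T - T) (T + T)) (V (T - T) (T + T)).
rewrite subrK => Hn.
by lra_context.
Qed.

(* Integrating [exp (al x / y)] in [x] gains a factor [1 / al]; for this [al]
   the contribution of [V_xy] is absorbed. *)
Let al := 8 * C.
Let W (x y : R) := root4 y * expR (al * x / y).

(** At fixed [y], integrate [V_xy] in [x] from the slice. For [x <= 0] one has [y - x >= y], and the
    integral of [exp (al z / y)] costs [y / al], which cancels [C / y] and leaves [1 / 8]. *)
Lemma exterior_b_step (Y m x y : R) : Y <= 1 -> 0 <= m ->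
  (forall x y : R, x <= 0 -> 2 * T <= x + y -> y <= Y -> `|V x y| <= m * W x y) ->
  x <= 0 -> 2 * T <= x + y -> y <= Y ->
  `|b x y| <= `|b (2 * T - y) y| + m / 8 * (root4 y / y) * expR (al * x / y).
Proof.
move: T0 T1 C0 => tpos tle cpos.
move=> Y1 m0 Hm x0 xy yY.
have y0 : 0 < y by lra_context.
pose F z := m / 8 * (root4 y / y) * expR (al * z / y).
have F0 z : 0 <= F z.
  by rewrite !mulr_ge0 ?invr_ge0 ?expR_ge0 ?root4_ge0// ltW.
have : `|b x y - b (2 * T - y) y| <= F x - F (2 * T - y).
  apply: (@deriv_comparison R (b ^~ y) F (g ^~ y)
   (fun z => C * m * root4 y / y ^+ 2 * expR (al * z / y))) => [|z /andP[z1 z2]|z _|z /andP[z1 z2]].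
  - lra_context.
  - by apply: (cw_bx cw); [lra_context|apply/andP; split; lra_context].
  - refine (deriv_eq (derivM (derivC _ z) (deriv_expR (derivM (derivM (derivC al z) (derivI z)) (derivC y^-1 z)))) _).
    by rewrite /al; field; rewrite gt_eqF.
  - have zy : z < y by lra_context.
    apply: le_trans (cw_g cw zy _) _; first by apply/andP; split; lra_context.
    have h1 : `|V z y| <= m * W z y by apply: Hm; lra_context.
    have h2' : ((y - z) ^+ 2)^-1 <= (y ^+ 2)^-1.
      have yz : 0 < y - z by lra_context.
      rewrite lef_pV2 ?posrE ?exprn_gt0//.
      by rewrite ler_pXn2r ?nnegrE//; lra_context.
    have -> : C * m * root4 y / y ^+ 2 * expR (al * z / y) = C * (m * W z y) / y ^+ 2.
      by rewrite /W; ring.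
    apply: ler_pM => //; rewrite ?invr_ge0 ?sqr_ge0//.
      by rewrite mulr_ge0 ?(ltW cpos).
    by rewrite (ler_wpM2l (ltW cpos)).
have := ler_normD (b x y - b (2 * T - y) y) (b (2 * T - y) y).
rewrite subrK -/(F x) => h1 h2'.
by have := F0 (2 * T - y); lra_context.
Qed.

(** Integrating [exterior_b_step] in [y] returns half of the supremum of [|V| / W] over the
    triangle, so [absorb_half] applies. In [2 C + 6], the part [2 C + 4] is [V] on the slice and [2]
    is the majorant of [b] there. The factor [expR al] compares [W] with [root4 y], as
    [-1 <= x / y <= 0]. *)
Lemma exterior_bound (Y N x y : R) : 2 * T <= Y <= 1 -> 0 < N -> S (Y - T) <= N ^+ 2 ->
  x <= 0 -> 2 * T <= x + y -> y <= Y ->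
  `|V x y| <= 2 * ((2 * C + 6) * expR al) * N * root4 y.
Proof.
move: T0 T1 C0 => tpos tle cpos.
move=> /andP[TY Y1] N0 SN x0 xy yY.
have al0 : 0 < al by rewrite /al; lra_context.
pose D (p : R * R) := [/\ p.1 <= 0, 2 * T <= p.1 + p.2 & p.2 <= Y].
have Dy p : D p -> 0 < p.2 by case=> *; lra_context.
have W0 p : D p -> 0 < W p.1 p.2.
  by move=> Dp; rewrite mulr_gt0 ?expR_gt0 ?root4_gt0 ?Dy.
have We p : D p -> root4 p.2 <= expR al * W p.1 p.2.
  move=> Dp; rewrite /W mulrCA ler_peMr ?root4_ge0// -expRD -expR0 ler_expR.
  have -> : al + al * p.1 / p.2 = al * ((p.1 + p.2) / p.2).
    by field; rewrite gt_eqF ?Dy.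
  rewrite mulr_ge0 ?(ltW al0)// divr_ge0 ?(ltW (Dy _ _))//.
  by case: Dp => *; lra_context.
suff : `|V x y| / W x y <= 2 * ((2 * C + 6) * N * expR al).
  have Dp : D (x, y) by split.
  have := W0 _ Dp => /= Wp.
  rewrite ler_pdivrMr// => h; apply: le_trans h _.
  have -> : 2 * ((2 * C + 6) * expR al) * N * root4 y = 2 * ((2 * C + 6) * N * expR al) * root4 y.
    by ring.
  have K0 : 0 <= 2 * ((2 * C + 6) * N * expR al).
    by rewrite !mulr_ge0 ?expR_ge0 ?(ltW N0)//; lra_context.
  rewrite (ler_wpM2l K0)//.
  rewrite /W ler_piMr ?root4_ge0// -expR0 ler_expR.
  by rewrite pmulr_lle0 ?invr_gt0 ?(Dy _ Dp)// pmulr_rle0.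
apply: (@absorb_half R (R * R)%type D (fun p => `|V p.1 p.2| / W p.1 p.2)
  ((2 * C + 6) * N * expR al) (2 * C * expR al) _ _ (x, y)) => // [p Dp|m Hm p Dp].
- rewrite ler_pdivrMr ?W0//.
  have [p1 p2 p3] := Dp; have p0 := Dy _ Dp.
  have pp : p.1 < p.2 by lra_context.
  apply: le_trans (cw_V cw pp _) _; first by apply/andP; split; lra_context.
  (* Here [Y <= 1] enters: [y - x <= 2 y], and [y <= y^(1/2)]. *)
  apply: (@le_trans _ _ (C * (2 * root4 p.2))).
    rewrite (ler_wpM2l (ltW cpos))//.
    rewrite -(@ler_pXn2r _ 2) ?nnegrE ?mulr_ge0 ?sqrtr_ge0 ?root4_ge0//.
    have pd : 0 <= p.2 - p.1 by lra_context.
    rewrite (sqr_sqrtr pd) exprMn root4_sq.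
    have s1 : p.2 <= Num.sqrt p.2.
      rewrite -(@ler_pXn2r _ 2) ?nnegrE ?sqrtr_ge0 ?(ltW p0)//.
      by rewrite (sqr_sqrtr (ltW p0)) expr2 ler_piMr//; lra_context.
    lra_context.
  have := We _ Dp; rewrite -(ler_pM2l C0); lra_context.
- have m0 : 0 <= m.
    by apply: le_trans (Hm p Dp); rewrite divr_ge0// ltW// W0.
  have Hm' (z w : R) : z <= 0 -> 2 * T <= z + w -> w <= Y -> `|V z w| <= m * W z w.
    move=> *; have Dz : D (z, w) by split.
    by rewrite -ler_pdivrMr ?(W0 _ Dz)//; exact: (Hm _ Dz).
  rewrite ler_pdivrMr ?W0// mulrDl.
  have := We _ Dp; have p0 := Dy _ Dp; case: Dp; case: p p0 => z w /= w0 z0 zw wY Wzw.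
  have r1 : T <= w - T <= 1 by apply/andP; split; lra_context.
  have SN1 : S (w - T) <= N ^+ 2.
    by apply: le_trans (weighted_energy_mono _ _ _) SN; lra_context.
  have [A [dA [Ar HA]]] := slice_majorant r1 N0 SN1.
  (* Since [root4' = root4 s / (4 s)], the [m / 8] becomes [m / 2]. The exponential is frozen at
     [s = w], its maximum on the segment because [z <= 0]. *)
  pose F s := A (s - T) + m / 2 * expR (al * z / w) * root4 s.
  have hF : `|V z w - V z (2 * T - z)| <= F w - F (2 * T - z).
    apply: (@deriv_comparison R (V z) F (b z)
      (fun s => dA (s - T) + m / 8 * (root4 s / s) * expR (al * z / w))) => [|s /andP[s1 s2]|s /andP[s1 s2]|s /andP[s1 s2]].
    - lra_context.
    - by apply: (cw_Vy cw); [lra_context|apply/andP; split; lra_context].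
    - have [_ dAs _ _] : [/\ 0 <= A (s - T), is_derive (s - T) 1 A (dA (s - T)), 
        `|a (T - (s - T)) (T + (s - T))| <= dA (s - T) & `|b (T - (s - T)) (T + (s - T))| <= dA (s - T)].
        by apply: HA; apply/andP; split; lra_context.
      have s0 : 0 < s by lra_context.
      refine (deriv_eq (derivD (@deriv_comp _ A (fun s => s - T) s _ _ dAs (derivB (derivI s) (derivC T s))) (derivM (derivC _ s) (deriv_root4 s0))) _).
      by field; rewrite gt_eqF.
    - have h : `|b z s| <= `|b (2 * T - s) s| + m / 8 * (root4 s / s) * expR (al * z / s).
        by apply: (exterior_b_step Y1 m0 Hm'); lra_context.
      apply: le_trans h _; apply: lerD.
        have [_ _ _] : [/\ 0 <= A (s - T), is_derive (s - T) 1 A (dA (s - T)), 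
        `|a (T - (s - T)) (T + (s - T))| <= dA (s - T) & `|b (T - (s - T)) (T + (s - T))| <= dA (s - T)].
          by apply: HA; apply/andP; split; lra_context.
        have -> : T - (s - T) = 2 * T - s by ring.
        by have -> : T + (s - T) = s by ring.
      have s0 : 0 < s by lra_context.
      rewrite ler_wpM2l//.
        by rewrite !mulr_ge0 ?invr_ge0 ?root4_ge0// ltW.
      rewrite ler_expR -2!(mulrA al) (ler_wpM2l (ltW al0))//.
      by rewrite ler_wnM2l// lef_pV2 ?posrE.
  have r2 : T <= T - z <= 1 by apply/andP; split; lra_context.
  have SN2 : S (T - z) <= N ^+ 2.
    by apply: le_trans (weighted_energy_mono _ _ _) SN1; lra_context.
  have := slice_bound r2 N0 SN2.
  have -> : T - (T - z) = z by ring.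
  have -> : T + (T - z) = 2 * T - z by ring.
  move=> h0.
  have F0 : 0 <= F (2 * T - z).
    rewrite addr_ge0//; last by rewrite !mulr_ge0 ?expR_ge0 ?root4_ge0.
    have [//] : [/\ 0 <= A (2 * T - z - T), is_derive (2 * T - z - T) 1 A (dA (2 * T - z - T)), 
        `|a (T - (2 * T - z - T)) (T + (2 * T - z - T))| <= dA (2 * T - z - T) & `|b (T - (2 * T - z - T)) (T + (2 * T - z - T))| <= dA (2 * T - z - T)].
    by apply: HA; apply/andP; split; lra_context.
  have q1 : root4 (T - z) <= root4 w by apply: root4_le; lra_context.
  have q2 : root4 (w - T) <= root4 w by apply: root4_le; lra_context.
  have := ler_normD (V z w - V z (2 * T - z)) (V z (2 * T - z)).
  rewrite subrK => h1.
  have h2' : F w <= 2 * N * root4 w + m / 2 * W z w.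
    rewrite /F lerD//.
      by apply: le_trans Ar _; rewrite ler_wpM2l// mulr_ge0// ltW.
    by rewrite /W mulrAC mulrA.
  have h3 : (2 * C + 4) * N * root4 (T - z) <= (2 * C + 4) * N * root4 w.
    rewrite ler_wpM2l// mulr_ge0 ?(ltW N0)//; lra_context.
  have h4 : (2 * C + 6) * N * root4 w <= (2 * C + 6) * N * (expR al * W z w).
    rewrite ler_wpM2l// mulr_ge0 ?(ltW N0)//; lra_context.
  lra_context.
Qed.

End Exterior.

(** * The flux through the cone *)

Section ConeFlux.
Context {R : realType} {C : R} {V a b g : R -> R -> R} (cw : char_wave C V a b g).
Context {T : R} (T0 : 0 < T) (T1 : 2 * T <= 1).
Context {H S : R -> R}.

Let h2 (r : R) := a (T - r) (T + r) ^+ 2 + b (T - r) (T + r) ^+ 2.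

Context (dH : forall r : R, T <= r <= 1 -> is_derive r 1 H (h2 r)).
Context (dS : forall r : R, T <= r <= 1 -> is_derive r 1 S (h2 r * Num.sqrt r)).
Context (HT : H T = 0) (ST : S T = Num.sqrt T).

Let C0 : 0 < C.
Proof. exact: (cw_C cw). Qed.

Let al := 8 * C.

(** For the line [y = Y] only radii up to [Y - T] on the slice matter, so [exterior_bound] applies
    with [N^2 = S (Y - T)]. Then [V_xy] is at most a multiple of [N Y^(1/4) / Y^2] on a segment of
    length at most [Y], and the square of its integral is of order [S / Y^(3/2)]. *)
Lemma cone_density_bound (Y : R) : 2 * T <= Y <= 1 ->
  b 0 Y ^+ 2 <= 2 * h2 (Y - T) +
    2 * (C * (2 * ((2 * C + 6) * expR al))) ^+ 2 * (S (Y - T) / ((Y - T) * Num.sqrt (Y - T))).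
Proof.
move: T0 T1 C0 => tpos tle cpos.
move=> /[dup] TYY /andP[TY Y1].
set K := 2 * ((2 * C + 6) * expR al).
have K0 : 0 <= K by rewrite !mulr_ge0 ?expR_ge0//; lra_context.
have S0 : 0 < S (Y - T).
  apply: (@lt_le_trans _ _ (S T)); first by rewrite ST sqrtr_gt0.
  by apply: (weighted_energy_mono cw T0 T1 dS); lra_context.
pose N := Num.sqrt (S (Y - T)).
have N0 : 0 < N by rewrite sqrtr_gt0.
have SN : S (Y - T) <= N ^+ 2 by rewrite sqr_sqrtr// ltW.
have y0 : 0 < Y by lra_context.
pose k := C * (K * N * root4 Y) / Y ^+ 2.
have k0 : 0 <= k.
  rewrite divr_ge0 ?sqr_ge0// (mulr_ge0 (ltW cpos))//.
  exact: mulr_ge0 (mulr_ge0 K0 (ltW N0)) (root4_ge0 Y).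
have hb : `|b 0 Y - b (2 * T - Y) Y| <= k * 0 - k * (2 * T - Y).
  apply: (@deriv_comparison R (b ^~ Y) (fun z => k * z) (g ^~ Y) (fun=> k)) => [|z /andP[z1 z2]|z _|z /andP[z1 z2]].
  - lra_context.
  - by apply: (cw_bx cw); lra_context.
  - by refine (deriv_eq (derivM (derivC k z) (derivI z)) _); ring.
  - have zy : z < Y by lra_context.
    apply: le_trans (cw_g cw zy _) _; first lra_context.
    have h1 : `|V z Y| <= K * N * root4 Y by apply: (exterior_bound cw T0 T1 dS ST TYY N0 SN); lra_context.
    have h2' : ((Y - z) ^+ 2)^-1 <= (Y ^+ 2)^-1.
      have yz : 0 < Y - z by lra_context.
      rewrite lef_pV2 ?posrE ?exprn_gt0//.
      by rewrite ler_pXn2r ?nnegrE//; lra_context.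
    apply: ler_pM => //; rewrite ?invr_ge0 ?sqr_ge0//.
      by rewrite mulr_ge0 ?(ltW cpos).
    by rewrite (ler_wpM2l (ltW cpos)).
have hk : k * 0 - k * (2 * T - Y) <= k * Y.
  have : 0 <= k * T by rewrite mulr_ge0// ltW.
  lra_context.
have hb2 : `|b 0 Y| <= `|b (2 * T - Y) Y| + k * Y.
  have := ler_normD (b 0 Y - b (2 * T - Y) Y) (b (2 * T - Y) Y).
  by rewrite subrK; lra_context.
have hs : (k * Y) ^+ 2 <= (C * K) ^+ 2 * (S (Y - T) / ((Y - T) * Num.sqrt (Y - T))).
  have -> : (k * Y) ^+ 2 = (C * K) ^+ 2 * (S (Y - T) / (Y * Num.sqrt Y)).
    have -> : S (Y - T) = N ^+ 2 by rewrite sqr_sqrtr// ltW.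
    have E : Y = root4 Y ^+ 4.
      by rewrite (exprM _ 2 2) root4_sq sqr_sqrtr// ltW.
    have q0 := root4_gt0 y0.
    have aux (q y : R) : 0 < q -> y = q ^+ 4 ->
      (C * (K * N * q) / y ^+ 2 * y) ^+ 2 = (C * K) ^+ 2 * (N ^+ 2 / (y * q ^+ 2)).
      by move=> qpos ->; field; rewrite gt_eqF.
    by rewrite -root4_sq /k; exact: aux.
  rewrite ler_wpM2l ?sqr_ge0// ler_wpM2l ?(ltW S0)//.
  have r0 : 0 < Y - T by lra_context.
  rewrite lef_pV2 ?posrE ?mulr_gt0 ?sqrtr_gt0//.
  by rewrite ler_pM ?sqrtr_ge0 ?ler_wsqrtr//; lra_context.
have hh : b (2 * T - Y) Y ^+ 2 <= h2 (Y - T).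
  rewrite /h2.
  have -> : T - (Y - T) = 2 * T - Y by ring.
  have -> : T + (Y - T) = Y by ring.
  by rewrite lerDr sqr_ge0.
have hq : b 0 Y ^+ 2 <= (`|b (2 * T - Y) Y| + k * Y) ^+ 2.
  rewrite -[in leLHS]real_normK ?num_real// ler_pXn2r ?nnegrE//.
  by rewrite addr_ge0// mulr_ge0// ltW.
have hb3 : b (2 * T - Y) Y ^+ 2 = `|b (2 * T - Y) Y| ^+ 2 by rewrite real_normK ?num_real.
have := sqr_ge0 (`|b (2 * T - Y) Y| - k * Y).
move: hq hs hh; rewrite hb3.
move: (`|b (2 * T - Y) Y|) (k * Y) (S (Y - T) / _) => u w z hq hs hh hz.
nra.
Qed.

(** The point is a bound free of [T]. By parts, the integral of [S / r^(3/2)] is at most twice that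
    of [h2] plus [2 S(T) / T^(1/2)]; the first is at most [2 C], and the normalisation of [S] makes
    the second equal to 2. *)
Lemma cone_flux_bound_at (y0 : R) (Phi : R -> R) : 2 * T <= y0 -> y0 <= 1 ->
  (forall y : R, 2 * T <= y <= y0 -> is_derive y 1 Phi (b 0 y ^+ 2)) ->
  Phi y0 - Phi (2 * T) <= 2 * C +
    2 * (C * (2 * ((2 * C + 6) * expR al))) ^+ 2 * (2 * C + 2).
Proof.
move: T0 T1 C0 HT ST => tpos tle cpos ht st.
move=> Ty y1 dPhi.
set K := 2 * (_) ^+ 2.
have K0 : 0 <= K by rewrite mulr_ge0 ?sqr_ge0.
have s0 : 0 < Num.sqrt T by rewrite sqrtr_gt0.
(* The last term of [Psi] comes from
   [(- 2 S / r^(1/2))' = S / r^(3/2) - 2 h2]. *)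
pose Psi r := 2 * H r + K * (2 * H r - 2 * (S r / Num.sqrt r)).
have hPsi : `|Phi y0 - Phi (2 * T)| <= Psi (y0 - T) - Psi (2 * T - T).
  apply: (@deriv_comparison R Phi (fun y => Psi (y - T)) (fun y => b 0 y ^+ 2)
    (fun y => 2 * h2 (y - T) + K * (S (y - T) / ((y - T) * Num.sqrt (y - T))))) => // y /andP[yT yy].
  - have r0 : 0 < y - T by lra_context.
    have sr0 : 0 < Num.sqrt (y - T) by rewrite sqrtr_gt0.
    have dHr : is_derive (y - T) 1 H (h2 (y - T)) by apply: dH; lra_context.
    have dSr : is_derive (y - T) 1 S (h2 (y - T) * Num.sqrt (y - T)) by apply: dS; lra_context.
    have dV := @derivV _ Num.sqrt _ _ (lt0r_neq0 sr0) (@deriv_sqrt _ (fun z => z) _ _ r0 (derivI (y - T))).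
    have dP := derivD (derivM (derivC 2 _) dHr) (derivM (derivC K _)
      (derivB (derivM (derivC 2 _) dHr) (derivM (derivC 2 _) (derivM dSr dV)))).
    refine (deriv_eq (@deriv_comp _ Psi (fun y => y - T) y _ _ dP (derivB (derivI y) (derivC T y))) _).
    have E : y - T = Num.sqrt (y - T) ^+ 2 by rewrite sqr_sqrtr// ltW.
    have aux (r s s1 h H1 : R) : 0 < s -> r = s ^+ 2 ->
        (0 * H1 + 2 * h + (0 * (2 * H1 - 2 * (s1 / s)) + K * (0 * H1 + 2 * h -
          (0 * (s1 / s) + 2 * (h * s / s + s1 * (- (1 / (2 * s)) / s ^+ 2)))))) * (1 - 0)
        = 2 * h + K * (s1 / (r * s)).
      by move=> sp ->; field; rewrite gt_eqF.
    exact: aux sr0 E.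
  - rewrite ger0_norm ?sqr_ge0//.
    by apply: cone_density_bound; lra_context.
have HC : H (y0 - T) <= C.
  have -> : H (y0 - T) = H (y0 - T) - H T by rewrite ht subr0.
  apply: (cw_E cw (t := T)) => [|//||r rr]; [lra_context|lra_context|].
  by apply: dH; lra_context.
have h1 : Psi (y0 - T) <= 2 * C + K * (2 * C).
  rewrite /Psi lerD//; first lra_context.
  rewrite ler_wpM2l//.
  have : 0 <= S (y0 - T) / Num.sqrt (y0 - T).
    rewrite divr_ge0 ?sqrtr_ge0//; apply: (@le_trans _ _ (S T)).
      by rewrite st ltW.
    by apply: (weighted_energy_mono cw T0 T1 dS); lra_context.
  lra_context.
have h2' : Psi (2 * T - T) = - 2 * K.
  have -> : 2 * T - T = T by ring.
  by rewrite /Psi ht st divff ?gt_eqF//; ring.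
have := ler_norm (Phi y0 - Phi (2 * T)); lra_context.
Qed.

End ConeFlux.

Lemma cone_flux_bound {R : realType} {C : R} {V a b g : R -> R -> R} :
  char_wave C V a b g -> exists K : R, forall (d y0 : R) (Phi : R -> R),
   0 < d -> d <= y0 -> y0 <= 1 ->
   (forall y : R, d <= y <= y0 -> is_derive y 1 Phi (b 0 y ^+ 2)) ->
   Phi y0 - Phi d <= K.
Proof.
move=> cw; exists (2 * C + 2 * (C * (2 * ((2 * C + 6) * expR (8 * C)))) ^+ 2 * (2 * C + 2)).
move=> d y0 Phi d0 dy y1 dPhi.
(* The slice [x + y = 2 T] meets the cone [x = 0] at [y = d]. *)
pose T := d / 2; have dT : d = 2 * T by rewrite /T; field.
have T0 : 0 < T by rewrite divr_gt0.
have T1 : 2 * T <= 1 by rewrite -dT; lra_context.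
pose h r := a (T - r) (T + r) ^+ 2 + b (T - r) (T + r) ^+ 2.
have T2 : T / 2 < 2 by lra_context.
have ch r : T / 2 <= r <= 2 -> {for r, continuous h}.
  move=> /andP[r0 _]; apply: (slice_density_continuous cw); lra_context.
have [H0 [_ dH0]] := primitive_exists T2 ch.
have [S0 [_ dS0]] := @primitive_exists R (fun r => h r * Num.sqrt r) _ _ T2
  (fun r hr => cvgM (ch r hr) (@sqrt_continuous R r)).
have dH (r : R) : T <= r <= 1 -> is_derive r 1 (fun r => H0 r - H0 T) (h r).
  move=> /andP[rT r1].
  have dHr : is_derive r 1 H0 (h r) by apply: dH0; lra_context.
  by refine (deriv_eq (derivB dHr (derivC _ r)) _); rewrite subr0.
have dS (r : R) : T <= r <= 1 ->
    is_derive r 1 (fun r => S0 r - S0 T + Num.sqrt T) (h r * Num.sqrt r).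
  move=> /andP[rT r1].
  have dSr : is_derive r 1 S0 (h r * Num.sqrt r) by apply: dS0; lra_context.
  by refine (deriv_eq (derivD (derivB dSr (derivC _ r)) (derivC _ r)) _); rewrite subr0 addr0.
have HT : H0 T - H0 T = 0 by rewrite subrr.
have ST : S0 T - S0 T + Num.sqrt T = Num.sqrt T by rewrite subrr add0r.
have := @cone_flux_bound_at R C V a b g cw T T0 T1 _ _ dH dS HT ST y0 Phi.
by rewrite -dT; apply.
Qed.

(** * The interior of the cone *)

Section Interior.
Context {R : realType} {C : R} {V a b g : R -> R -> R}.

Lemma cone_density_continuous (cw : char_wave C V a b g) (y : R) : 0 < y < 2 ->
  {for y, continuous (fun y => b 0 y ^+ 2)}.
Proof.
move=> /andP[y0 y2].
have c : {for y, continuous (fun y => b 0 y)}.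
  apply: (@continuous_along _ b (fun=> 0) (fun y => y)); [exact: cvg_cst|exact: cvg_id|].
  by apply: (cw_cb cw); rewrite ?add0r ?y0.
exact: (cvgM c c).
Qed.

(** The flux over [[d, 1]] is bounded and grows as [d] decreases. Once it is within [e] of its
    supremum, an interval below [d] carries at most [e]. *)
Lemma cone_flux_tail (cw : char_wave C V a b g) (e : R) : 0 < e ->
  exists2 y1, 0 < y1 <= 1 & forall (d y : R) (Phi : R -> R),
   0 < d -> d <= y -> y <= y1 ->
   (forall z : R, d <= z <= y -> is_derive z 1 Phi (b 0 z ^+ 2)) ->
   Phi y - Phi d <= e.
Proof.
move=> e0; have [K HK] := cone_flux_bound cw.
have primb (d : R) : 0 < d -> d <= 1 -> exists Phi : R -> R,
    forall z : R, d <= z <= 1 -> is_derive z 1 Phi (b 0 z ^+ 2).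
  move=> d0 d1.
  have [||F [_ dF]] := @primitive_exists R (fun y => b 0 y ^+ 2) (d / 2) (3 / 2).
  - lra_context.
  - by move=> x xd; apply: (cone_density_continuous cw); lra_context.
  - by exists F => z zd; apply: dF; lra_context.
pose P (s : R) := exists d (Phi : R -> R), [/\ 0 < d, d <= 1,
   forall z : R, d <= z <= 1 -> is_derive z 1 Phi (b 0 z ^+ 2) & s = Phi 1 - Phi d].
have Pub : ubound P K by move=> s [d [Phi [d0 d1 dP ->]]]; exact: HK.
have P0 : P !=set0.
  have [Phi dP] := primb 1 ltr01 (lexx 1).
  by exists (Phi 1 - Phi 1), 1, Phi; split.
have supP : has_sup P by split => //; exists K.
have [s [d [Phi [d0 d1 dP ->]]] hs] := sup_adherent e0 supP.
exists d; first by rewrite d0.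
move=> d' y Phi' d'0 d'y yd dP'.
have d'd : d' <= d by lra_context.
have [Psi dPsi] := primb d' d'0 (le_trans d'd d1).
have u1 : Phi' y - Phi' d' = Psi y - Psi d'.
  apply: (primitive_unique d'y dP') => x xd; apply: dPsi; lra_context.
have u2 : Phi 1 - Phi d = Psi 1 - Psi d.
  apply: (primitive_unique d1 dP) => x xd; apply: dPsi; lra_context.
have u3 : Psi y <= Psi d.
  apply: (@ndecr_of_deriv R Psi (fun z => b 0 z ^+ 2)) => // [x xd|x _]; last exact: sqr_ge0.
  by apply: dPsi; lra_context.
have u4 : Psi 1 - Psi d' <= sup P.
  by apply: sup_upper_bound => //; exists d', Psi; split => //; exact: le_trans d1.
lra_context.
Qed.

(** At the point [e^2 y] the bound [cw_V] already carries a factor [e]; from there to [y],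
    Cauchy-Schwarz with flux at most [e^2] adds [e y^(1/2)]. *)
Lemma cone_value_small (cw : char_wave C V a b g) (e y1 : R) : 0 < e -> e < 1 -> y1 <= 1 ->
  (forall (d y : R) (Phi : R -> R), 0 < d -> d <= y -> y <= y1 ->
   (forall z : R, d <= z <= y -> is_derive z 1 Phi (b 0 z ^+ 2)) ->
   Phi y - Phi d <= e ^+ 2) ->
  forall y : R, 0 < y -> y <= y1 -> `|V 0 y| <= (C + 1) * e * Num.sqrt y.
Proof.
move=> e0 e1 y11 tail y y0 yy1.
have sy0 : 0 < Num.sqrt y by rewrite sqrtr_gt0.
have d0 : 0 < e ^+ 2 * y by rewrite mulr_gt0// exprn_gt0.
have dy : e ^+ 2 * y <= y by rewrite ler_piMl ?(ltW y0)// expr_le1// ltW.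
have [||Phi [_ dPhi]] := @primitive_exists R (fun y => b 0 y ^+ 2) (e ^+ 2 * y / 2) (3 / 2).
- lra_context.
- by move=> x xd; apply: (cone_density_continuous cw); lra_context.
have tl : Phi y - Phi (e ^+ 2 * y) <= e ^+ 2.
  by apply: tail => // z zd; apply: dPhi; lra_context.
(* The minimiser of [(m e^2 + y / m) / 2]. *)
pose m := Num.sqrt y / e.
have m0 : 0 < m by rewrite divr_gt0.
pose F z := (m * Phi z + z / m) / 2.
have hF : `|V 0 y - V 0 (e ^+ 2 * y)| <= F y - F (e ^+ 2 * y).
  apply: (@deriv_comparison R (V 0) F (b 0) (fun z => (m * b 0 z ^+ 2 + m^-1) / 2)) => [//|z zd|z zd|z zd].
  - by apply: (cw_Vy cw); lra_context.
  - have dz : is_derive z 1 Phi (b 0 z ^+ 2) by apply: dPhi; lra_context.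
    refine (deriv_eq (derivM (derivD (derivM (derivC m z) dz) (derivM (derivI z) (derivC m^-1 z))) (derivC 2^-1 z)) _).
    by rewrite /=; field; rewrite gt_eqF.
  - by have := young_abs (b 0 z) m0 (@ltr01 R); rewrite !mulr1.
have hF2 : F y - F (e ^+ 2 * y) <= e * Num.sqrt y.
  have h1 : m * (Phi y - Phi (e ^+ 2 * y)) <= e * Num.sqrt y.
    apply: (@le_trans _ _ (m * e ^+ 2)); first by rewrite (ler_wpM2l (ltW m0)).
    by rewrite le_eqVlt; apply/orP; left; apply/eqP; rewrite /m; field; rewrite gt_eqF.
  have h2 : y / m = e * Num.sqrt y.
    rewrite -[X in X / m](sqr_sqrtr (ltW y0)) /m; field.
    by rewrite !gt_eqF.
  have h3 : 0 <= e ^+ 2 * y / m by rewrite divr_ge0// ltW.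
  by rewrite /F; lra_context.
have hV : `|V 0 (e ^+ 2 * y)| <= C * e * Num.sqrt y.
  have d2 : 0 < 0 + e ^+ 2 * y < 2 by lra_context.
  apply: le_trans (cw_V cw d0 d2) _.
  by rewrite subr0 sqrtrM ?sqr_ge0// sqrtr_sqr gtr0_norm// mulrA.
have := ler_normD (V 0 y - V 0 (e ^+ 2 * y)) (V 0 (e ^+ 2 * y)).
rewrite subrK; lra_context.
Qed.

Section Region.
Context (cw : char_wave C V a b g) (y1 k K1 : R).
Context (y10 : 0 < y1) (y11 : y1 <= 1) (k0 : 0 < k) (k1 : k < 1).
Context (aK1 : forall x : R, 0 <= x <= k * y1 -> `|a x y1| <= K1).

(* In the sector [x <= k y] one has [(y - x)^-2 <= c y^-2]. *)
Let c := (1 - k)^-1 ^+ 2.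

Let g_le (M x y : R) : 0 <= x -> 0 < y -> x <= k * y -> y <= y1 -> `|V x y| <= M ->
  `|g x y| <= C * c * M / y ^+ 2.
Proof.
move: (cw_C cw) y10 y11 k0 k1 => cpos y1pos y1le kpos klt.
move=> x0 y0 xy yy VM.
have ky : k * y < y by rewrite gtr_pMl.
have xly : x < y by lra_context.
apply: le_trans (cw_g cw xly _) _; first lra_context.
have ck : 0 < 1 - k by lra_context.
have -> : C * c * M / y ^+ 2 = C * M / ((1 - k) * y) ^+ 2.
  by rewrite /c; field; rewrite !gt_eqF.
have q0 : 0 < (1 - k) * y by rewrite mulr_gt0.
apply: ler_pM => //; rewrite ?invr_ge0 ?sqr_ge0//.
- by rewrite mulr_ge0// ltW.
- by rewrite (ler_wpM2l (ltW cpos)).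
- have yx : (1 - k) * y <= y - x by lra_context.
  rewrite lef_pV2 ?posrE ?exprn_gt0//; last lra_context.
  by rewrite ler_pXn2r ?nnegrE//; lra_context.
Qed.

(** Integrate [V_xy] in [y] down from [y1]: the segment stays in the sector, and [z^(1/2) / z^2]
    integrates to at most [2 / y^(1/2)]. [K1] is bounded but not small; it becomes negligible
    against [y^(-1/2)] near the tip. *)
Lemma interior_a_step (M x y : R) : 0 <= M -> 0 <= x -> 0 < y -> x <= k * y -> y <= y1 ->
  (forall z : R, y <= z <= y1 -> `|V x z| <= M * Num.sqrt z) ->
  `|a x y| <= K1 + 2 * (C * c) * M / Num.sqrt y.
Proof.
move: (cw_C cw) y10 y11 k0 k1 => cpos y1pos y1le kpos klt.
move=> M0 x0 y0 xy yy HV.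
have ck : 0 < 1 - k by lra_context.
have c0 : 0 < c by rewrite /c exprn_gt0// invr_gt0.
pose D := 2 * (C * c) * M.
have Cc : 0 <= C * c := mulr_ge0 (ltW cpos) (ltW c0).
have D0 : 0 <= D by rewrite /D (mulr_ge0 _ M0)// (mulr_ge0 _ Cc).
have h : `|a x y1 - a x y| <= - D / Num.sqrt y1 - (- D / Num.sqrt y).
  apply: (@deriv_comparison R (a x) (fun z => - D / Num.sqrt z) (g x)
    (fun z => D / 2 * Num.sqrt z / z ^+ 2)) => [//|z /andP[z1 z2]|z /andP[z1 z2]|z /andP[z1 z2]].
  - have kz : k * z < z by rewrite gtr_pMl//; lra_context.
    have kyz : k * y <= k * z by rewrite ler_pM2l.
    apply: (cw_ay cw); last lra_context.
    lra_context.
  - have z0 : 0 < z by lra_context.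
    have sz : 0 < Num.sqrt z by rewrite sqrtr_gt0.
    have dV := @derivV _ Num.sqrt _ _ (lt0r_neq0 sz) (@deriv_sqrt _ (fun z => z) _ _ z0 (derivI z)).
    refine (deriv_eq (derivM (derivC (- D) z) dV) _).
    have aux (s t : R) : 0 < s -> t = s ^+ 2 ->
      0 / s + - D * (- (1 / (2 * s)) / s ^+ 2) = D / 2 * s / t ^+ 2.
      by move=> s0 ->; field; rewrite gt_eqF.
    by apply: aux => //; rewrite sqr_sqrtr// ltW.
  - have z0 : 0 < z by lra_context.
    have kyz : k * y <= k * z by rewrite ler_pM2l.
    have hz : `|V x z| <= M * Num.sqrt z by apply: HV; lra_context.
    apply: le_trans (@g_le (M * Num.sqrt z) x z _ _ _ _ _) _ => //; first lra_context.
    by rewrite le_eqVlt; apply/orP; left; apply/eqP; rewrite /D /c; field; rewrite !gt_eqF.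
have h1 : `|a x y1| <= K1.
  have : k * y <= k * y1 by rewrite ler_pM2l.
  by move=> kyy; apply: aK1; lra_context.
have h2 : 0 <= D / Num.sqrt y1 by rewrite divr_ge0 ?sqrtr_ge0.
have := ler_normB (a x y1) (a x y1 - a x y).
have -> : a x y1 - (a x y1 - a x y) = a x y by ring.
rewrite -/D !mulNr in h *; lra_context.
Qed.

(** The segment from the cone at height [y] has length at most [y], which against [y^(1/2) / y^2]
    leaves [y^(-1/2)]. *)
Lemma interior_b_step (M x y : R) : 0 <= M -> 0 <= x -> 0 < y -> x <= k * y -> y <= y1 ->
  (forall z : R, 0 <= z <= x -> `|V z y| <= M * Num.sqrt y) ->
  `|b x y| <= `|b 0 y| + C * c * M / Num.sqrt y.
Proof.
move: (cw_C cw) y10 y11 k0 k1 => cpos y1pos y1le kpos klt.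
move=> M0 x0 y0 xy yy HV.
have ky : k * y < y by rewrite gtr_pMl.
have c0 : 0 <= c by rewrite /c sqr_ge0.
have sy : 0 < Num.sqrt y by rewrite sqrtr_gt0.
pose D := C * c * (M * Num.sqrt y) / y ^+ 2.
have D0 : 0 <= D.
  have Cc : 0 <= C * c := mulr_ge0 (ltW cpos) c0.
  by rewrite /D divr_ge0 ?sqr_ge0// (mulr_ge0 Cc)// (mulr_ge0 M0)// ltW.
have h : `|b x y - b 0 y| <= D * x - D * 0.
  apply: (@deriv_comparison R (b ^~ y) (fun z => D * z) (g ^~ y) (fun=> D)) => [//|z /andP[z1 z2]|z /andP[z1 z2]|z /andP[z1 z2]].
  - by apply: (cw_bx cw); [lra_context | lra_context].
  - by refine (deriv_eq (derivM (derivC D z) (derivI z)) _); rewrite mul0r add0r mulr1.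
  - by apply: g_le => //; [lra_context | apply: HV; lra_context].
have h1 : D * x <= D * y by rewrite ler_wpM2l//; lra_context.
have h2 : D * y = C * c * M / Num.sqrt y.
  have aux (s t : R) : 0 < s -> t = s ^+ 2 ->
      C * c * (M * s) / t ^+ 2 * t = C * c * M / s.
    by move=> s0 ->; rewrite /c; field; rewrite !gt_eqF//; lra_context.
  by rewrite /D; apply: aux => //; rewrite sqr_sqrtr// ltW.
have := ler_normD (b x y - b 0 y) (b 0 y).
rewrite subrK; lra_context.
Qed.

(** Integrating [2 C c m exp (al x / y) / y^(1/2)] in [x] gives the factor [2 C c y / al = y / 2],
    hence [m / 2] times the weight, the half that is absorbed. *)
Let al := 4 * (C * c).

(** For [x >= 0] the weight [exp (al x / y)] decreases in [y], so above height [w] it is at most its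
    value at [w], and [interior_a_step] applies with [M = m exp (al s / w)]. Integrating [V_x] from
    the cone, the cone contributes [(C + 1) e], the [K1] term another [e], and the rest half of the
    supremum. The factor [expR al] bounds the weight, as [x <= y]. *)
Lemma interior_bound (e x1 x y : R) : 0 < e -> K1 ^+ 2 * x1 <= e ^+ 2 ->
  (forall y : R, 0 < y -> y <= y1 -> `|V 0 y| <= (C + 1) * e * Num.sqrt y) ->
  0 <= x -> x <= x1 -> 0 < y -> x <= k * y -> y <= y1 ->
  `|V x y| <= 2 * (C + 2) * expR al * e * Num.sqrt y.
Proof.
move: (cw_C cw) y10 y11 k0 k1 => cpos y1pos y1le kpos klt.
move=> e0 Kx1 Hcone x0 xx1 y0 xy yy1.
have ck : 0 < 1 - k by lra_context.
have c0 : 0 < c by rewrite /c exprn_gt0// invr_gt0.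
have al0 : 0 < al by rewrite /al mulr_gt0// mulr_gt0.
pose W (x y : R) := Num.sqrt y * expR (al * x / y).
pose D (p : R * R) := [/\ 0 <= p.1, p.1 <= x1, 0 < p.2, p.1 <= k * p.2 & p.2 <= y1].
have ratio p : D p -> 0 <= p.1 / p.2 <= 1.
  case=> q1 q2 q3 q4 q5; rewrite divr_ge0 ?(ltW q3)//= ler_pdivrMr// mul1r.
  have : k * p.2 < p.2 by rewrite gtr_pMl.
  lra_context.
have Ws p : D p -> Num.sqrt p.2 <= W p.1 p.2.
  move=> Dp; rewrite /W ler_peMr ?sqrtr_ge0// -expR0 ler_expR -mulrA.
  by rewrite mulr_ge0 ?(ltW al0)//; have /andP[] := ratio _ Dp.
have s0 p : D p -> 0 < Num.sqrt p.2 by case=> *; rewrite sqrtr_gt0.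
have W0 p : D p -> 0 < W p.1 p.2.
  by move=> Dp; apply: lt_le_trans (Ws _ Dp); exact: s0.
have Dxy : D (x, y) by split.
suff : `|V x y| / W x y <= 2 * ((C + 2) * e).
  rewrite (ler_pdivrMr _ _ (W0 _ Dxy)) => h; apply: le_trans h _.
  have -> : 2 * (C + 2) * expR al * e * Num.sqrt y = 2 * ((C + 2) * e) * (Num.sqrt y * expR al).
    by ring.
  have K0 : 0 <= 2 * ((C + 2) * e) by rewrite !mulr_ge0 ?(ltW e0)//; lra_context.
  rewrite (ler_wpM2l K0)// /W (ler_wpM2l (sqrtr_ge0 _))// ler_expR -(mulrA al).
  by rewrite ler_piMr ?(ltW al0)//; have /andP[] := ratio _ Dxy.
apply: (@absorb_half R (R * R)%type D (fun p => `|V p.1 p.2| / W p.1 p.2) _ C _ _ (x, y)) => // [p Dp|m Hm p Dp].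
- rewrite ler_pdivrMr ?W0//.
  have [q1 q2 q3 q4 q5] := Dp.
  have kp : k * p.2 < p.2 by rewrite gtr_pMl.
  have pp : p.1 < p.2 by lra_context.
  apply: le_trans (cw_V cw pp _) _; first lra_context.
  rewrite (ler_wpM2l (ltW cpos))//; apply: le_trans (Ws _ Dp).
  by rewrite ler_wsqrtr//; lra_context.
- have m0 : 0 <= m.
    by apply: le_trans (Hm p Dp); rewrite divr_ge0// ltW// W0.
  have Hm' (z w : R) : D (z, w) -> `|V z w| <= m * W z w.
    by move=> Dz; rewrite -(ler_pdivrMr _ _ (W0 _ Dz)); exact: (Hm _ Dz).
  rewrite (ler_pdivrMr _ _ (W0 _ Dp)) mulrDl.
  have := Ws _ Dp; have := s0 _ Dp; case: Dp; case: p => z w /= z0 zx1 w0 zw wy sw Wzw.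
  have ha (s : R) : 0 <= s <= z ->
      `|a s w| <= K1 + 2 * (C * c) * (m * expR (al * s / w)) / Num.sqrt w.
    move=> /andP[sp sz]; apply: interior_a_step => //; [by rewrite mulr_ge0 ?expR_ge0 | lra_context|].
    move=> t /andP[wt ty].
    have t0 : 0 < t by lra_context.
    have kwt : k * w <= k * t by rewrite ler_pM2l.
    apply: le_trans (Hm' s t _) _; first by split => //=; lra_context.
    rewrite /W mulrCA mulrC (ler_wpM2r (sqrtr_ge0 _))// (ler_wpM2l m0)// ler_expR.
    by rewrite -2!(mulrA al) (ler_wpM2l (ltW al0))// ler_wpM2l// lef_pV2 ?posrE.
  have hV : `|V z w - V 0 w| <= (K1 * z + m / 2 * W z w) - (K1 * 0 + m / 2 * W 0 w).
    apply: (@deriv_comparison R (V ^~ w) (fun s => K1 * s + m / 2 * W s w) (a ^~ w)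
      (fun s => K1 + 2 * (C * c) * (m * expR (al * s / w)) / Num.sqrt w)) => [//|s /andP[s1 s2]|s /andP[s1 s2]|s /andP[s1 s2]].
    - have kw : k * w < w by rewrite gtr_pMl.
      by apply: (cw_Vx cw); [lra_context|lra_context].
    - refine (deriv_eq (derivD (derivM (derivC K1 s) (derivI s))
       (derivM (derivC (m / 2) s) (derivM (derivC (Num.sqrt w) s)
          (deriv_expR (derivM (derivM (derivC al s) (derivI s)) (derivC w^-1 s)))))) _).
      have aux (q t E : R) : 0 < q -> t = q ^+ 2 ->
        0 * s + K1 * 1 + (0 * (q * E) + m / 2 * (0 * E + q * (E * ((0 * s + al * 1) / t + al * s * 0))))
        = K1 + 2 * (C * c) * (m * E) / q.
        by move=> qp ->; rewrite /al /c; field; rewrite !gt_eqF.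
      by apply: aux => //; rewrite sqr_sqrtr// ltW.
    - by apply: ha; lra_context.
  (* As [z <= x1] and [z <= w], [(K1 z)^2 <= (K1^2 x1) w <= e^2 w]. *)
  have hK : K1 * z <= e * Num.sqrt w.
    apply: (@le_trans _ _ `|K1 * z|); first exact: ler_norm.
    rewrite -(@ler_pXn2r _ 2) ?nnegrE ?mulr_ge0 ?(ltW e0) ?sqrtr_ge0//.
    rewrite real_normK ?num_real// !exprMn sqr_sqrtr ?(ltW w0)//.
    have kw : k * w < w by rewrite gtr_pMl.
    rewrite expr2 mulrA ler_pM//; last lra_context.
      by rewrite mulr_ge0// sqr_ge0.
    by apply: le_trans Kx1; rewrite ler_wpM2l ?sqr_ge0.
  have hm : 0 <= m / 2 * W 0 w.
    by rewrite mulr_ge0 ?mulr_ge0 ?sqrtr_ge0 ?expR_ge0// divr_ge0.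
  have hc := Hcone w w0 wy.
  have := ler_normD (V z w - V 0 w) (V 0 w).
  rewrite subrK => hn.
  have hs : (C + 2) * e * Num.sqrt w <= (C + 2) * e * W z w.
    by rewrite ler_wpM2l// mulr_ge0 ?(ltW e0)//; lra_context.
  lra_context.
Qed.

End Region.
End Interior.

(** The order of the choices matters: [e] from [eps], then [y1] from the flux tail, then [K1], which
    may be large because it bounds [V_x] on [y = y1], and [t0] last. On a slice the density is at
    most [2 V_y(0, t + r)^2 + Q]; the first term integrates to a flux, and [Q], of order [e^2 / t]
    up to a bounded term, is multiplied by a length at most [t]. *)
Lemma sector_energy_small {R : realType} {C : R} {V a b g : R -> R -> R}
    (lam eps : R) : char_wave C V a b g -> 0 < lam -> lam < 1 -> 0 < eps ->
  exists2 t0 : R, 0 < t0 & forall (t : R) (F : R -> R), 0 < t -> t < t0 ->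
    (forall r : R, lam * t <= r <= t -> is_derive r 1 F
       (a (t - r) (t + r) ^+ 2 + b (t - r) (t + r) ^+ 2 + (V (t - r) (t + r) / r) ^+ 2)) ->
    F t - F (lam * t) <= eps.
Proof.
move=> cw l0 l1 eps0.
have cpos := cw_C cw.
(* With [x = t - r] and [y = t + r], the condition [lam * t <= r] reads [x <= k * y]. *)
pose k := (1 - lam) / (1 + lam).
have k0 : 0 < k by rewrite divr_gt0; lra_context.
have k1 : k < 1 by rewrite ltr_pdivrMr; lra_context.
pose c := (1 - k)^-1 ^+ 2.
have c0 : 0 <= c by rewrite /c sqr_ge0.
pose m := 2 * (C + 2) * expR (4 * (C * c)).
have m0 : 0 <= m by rewrite mulr_ge0 ?expR_ge0//; lra_context.
(* [m] is the constant of [interior_bound]. In [P], [10 = 8 + 2] comes from the squares of [a] and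
   [b]; the last term bounds [(V / r)^2] by means of [y <= 2 t] and [r >= lam t]. *)
pose P := 10 * (C * c * m) ^+ 2 + 2 * m ^+ 2 / lam ^+ 2.
have P0 : 0 <= P.
  apply: addr_ge0; first exact: mulr_ge0 (ler0n _ 10) (sqr_ge0 _).
  exact: divr_ge0 (mulr_ge0 (ler0n _ 2) (sqr_ge0 _)) (sqr_ge0 _).
(* The factor [2 + P] collects the flux term [2 e^2] and the term [P e^2] of [Q t]; the cap [1 / 2]
   gives [e^2 <= e]. *)
pose e := Num.min (1 / 2) (eps / (2 * (2 + P))).
have P2 : 0 < 2 + P by lra_context.
have e0 : 0 < e by rewrite lt_min !divr_gt0// mulr_gt0.
have e1 : e <= 1 / 2 by rewrite ge_min lexx.
have e2 : (2 + P) * e ^+ 2 <= eps / 2.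
  apply: (@le_trans _ _ ((2 + P) * (eps / (2 * (2 + P))))).
    rewrite (ler_wpM2l (ltW P2))//; apply: (@le_trans _ _ e).
      by rewrite expr2 ler_piMr ?(ltW e0)//; lra_context.
    by rewrite ge_min lexx orbT.
  have aux (p : R) : 0 < p -> p * (eps / (2 * p)) = eps / 2.
    by move=> p0; field; rewrite gt_eqF.
  by rewrite aux.
have [y1 /andP[y10 y11] tail] := cone_flux_tail cw (exprn_gt0 2 e0).
have e11 : e < 1 by apply: le_lt_trans e1 _; lra_context.
have Hcone := cone_value_small cw e0 e11 y11 tail.
have [K1 aK1] : exists K1, forall x : R, 0 <= x <= k * y1 -> `|a x y1| <= K1.
  have ky : 0 <= k * y1 by rewrite mulr_ge0 ?ltW.
  have kyy : k * y1 < y1 by rewrite gtr_pMl.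
  have ca : {within `[0, k * y1], continuous (fun x => `|a x y1|)}.
    apply: continuous_in_subspaceT => x; rewrite inE/= in_itv/= => /andP[x0 xk].
    have cx : {for x, continuous (fun x => a x y1)}.
      apply: (@continuous_along _ a (fun x => x) (fun=> y1)); [exact: cvg_id|exact: cvg_cst|].
      by apply: (cw_ca cw); [lra_context|lra_context].
    exact: (cvg_norm cx).
  have [x0 _ hx0] := EVT_max ky ca.
  by exists `|a x0 y1| => x xk; apply: hx0; rewrite in_itv.
have K11 : 0 < K1 ^+ 2 + 1 by have := sqr_ge0 K1; lra_context.
pose x1 := e ^+ 2 / (K1 ^+ 2 + 1).
have x10 : 0 < x1 by rewrite divr_gt0// exprn_gt0.
have Kx1 : K1 ^+ 2 * x1 <= e ^+ 2.
  by rewrite /x1 mulrA ler_pdivrMr// mulrC ler_wpM2l ?sqr_ge0// lerDl.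
(* The three bounds ensure in turn [x <= t <= x1], [y <= 2 t <= y1] and [2 K1^2 t <= eps / 2]. *)
pose t0 := Num.min (Num.min x1 (y1 / 2)) (eps / (4 * (K1 ^+ 2 + 1))).
exists t0; first by rewrite !lt_min x10 !divr_gt0// mulr_gt0.
move=> t F tpos; rewrite !lt_min => /andP[/andP[tx1 ty1] teps] dF.
have lt0 : 0 < lam * t by rewrite mulr_gt0.
have lt1 : lam * t < t by rewrite gtr_pMl.
have ty : t + t <= y1 by clear -ty1; lra.
have t12 : t <= 1 / 2 by clear -ty y11; lra.
have [||Phi [_ dPhi]] := @primitive_exists R (fun y => b 0 y ^+ 2) (t / 2) (3 / 2).
- by clear -ty t12; lra.
- move=> y /andP[y0 y2]; apply: (cone_density_continuous cw).
  by clear -y0 y2 tpos; lra_context.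
have Phi_small : Phi (t + t) - Phi (t + lam * t) <= e ^+ 2.
  apply: tail => [|||z /andP[z1 z2]].
  - by clear -tpos lt0; lra.
  - by clear -lt1; lra.
  - by [].
  - by apply: dPhi; clear -tpos lt0 t12 z1 z2; lra_context.
pose Q := 2 * K1 ^+ 2 + P * e ^+ 2 / t.
have Q0 : 0 <= Q.
  apply: addr_ge0; first exact: mulr_ge0 (ler0n _ 2) (sqr_ge0 _).
  exact: divr_ge0 (mulr_ge0 P0 (sqr_ge0 _)) (ltW tpos).
pose G r := 2 * Phi (t + r) + Q * r.
have hG : `|F t - F (lam * t)| <= G t - G (lam * t).
  apply: (@deriv_comparison R F G _ (fun r => 2 * b 0 (t + r) ^+ 2 + Q) (lam * t) t (ltW lt1) dF)
    => r /andP[r1 r2].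
    have dPr : is_derive (t + r) 1 Phi (b 0 (t + r) ^+ 2) by apply: dPhi; lra_context.
    have dsh : is_derive r 1 (fun r => t + r) (0 + 1) := derivD (derivC t r) (derivI r).
    refine (deriv_eq (derivD (derivM (derivC 2 r) (@deriv_comp _ Phi _ r _ _ dPr dsh)) (derivM (derivC Q r) (derivI r))) _).
    by rewrite !mul0r !add0r !mulr1.
  set x := t - r; set y := t + r.
  have x0 : 0 <= x by rewrite /x; lra_context.
  have y0 : 0 < y by rewrite /y; lra_context.
  have t_y : t <= y by rewrite /y; lra_context.
  have xt : x <= t by rewrite /x; lra_context.
  have yy1 : y <= y1 by rewrite /y; lra_context.
  have xky : x <= k * y.
    rewrite /k mulrAC ler_pdivlMr; last lra_context.
    have : 0 <= r - lam * t by lra_context.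
    by rewrite /x /y; lra_context.
  have sy : 0 < Num.sqrt y by rewrite sqrtr_gt0.
  have M0 : 0 <= m * e by rewrite mulr_ge0// ltW.
  have HV (x' y' : R) : 0 <= x' -> x' <= x -> y <= y' -> y' <= y1 -> `|V x' y'| <= m * e * Num.sqrt y'.
    move=> h1 h2 h3 h4; apply: (interior_bound cw y10 y11 k0 k1 aK1 e0 Kx1 Hcone) => //.
    - lra_context.
    - lra_context.
    - have : k * y <= k * y' by rewrite ler_pM2l.
      lra_context.
  have ha : `|a x y| <= K1 + 2 * (C * c) * (m * e) / Num.sqrt y.
    by apply: (interior_a_step cw y10 y11 k0 k1 aK1) => // z /andP[z1 z2]; exact: HV.
  have hb : `|b x y| <= `|b 0 y| + C * c * (m * e) / Num.sqrt y.
    apply: (interior_b_step cw y10 y11 k0 k1) => // z /andP[z1 z2].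
    exact: HV.
  have hv : `|V x y| <= m * e * Num.sqrt y by exact: HV.
  rewrite ger0_norm; last by rewrite !addr_ge0 ?sqr_ge0.
  have iy : y^-1 <= t^-1 by rewrite lef_pV2.
  pose A := C * c * m.
  have sqs : Num.sqrt y ^- 2 = y^-1 by rewrite sqr_sqrtr// ltW.
  have hA : (A * e / Num.sqrt y) ^+ 2 <= A ^+ 2 * e ^+ 2 / t.
    by rewrite exprMn exprVn sqs exprMn ler_wpM2l// mulr_ge0 ?sqr_ge0.
  have ha2 : a x y ^+ 2 <= 2 * K1 ^+ 2 + 8 * (A ^+ 2 * e ^+ 2 / t).
    have E : 2 * (C * c) * (m * e) / Num.sqrt y = 2 * (A * e / Num.sqrt y) by rewrite /A; ring.
    rewrite E in ha.
    have := sqr_le_of_norm ha; have := sqr_add_le K1 (2 * (A * e / Num.sqrt y)).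
    by rewrite [(2 * _) ^+ 2]exprMn; clear -hA; lra.
  have hb2 : b x y ^+ 2 <= 2 * b 0 y ^+ 2 + 2 * (A ^+ 2 * e ^+ 2 / t).
    have E : C * c * (m * e) / Num.sqrt y = A * e / Num.sqrt y by rewrite /A; ring.
    rewrite E in hb.
    have := sqr_le_of_norm hb; have := sqr_add_le `|b 0 y| (A * e / Num.sqrt y).
    by rewrite real_normK ?num_real//; clear -hA; lra.
  have hv2 : (V x y / r) ^+ 2 <= 2 * m ^+ 2 / lam ^+ 2 * (e ^+ 2 / t).
    have r0 : 0 < r by lra_context.
    have h1 := sqr_le_of_norm hv.
    rewrite expr_div_n ler_pdivrMr ?exprn_gt0//.
    apply: le_trans h1 _; rewrite exprMn sqr_sqrtr ?(ltW y0)//.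
    have h2 : y <= 2 * t by rewrite /y; lra_context.
    have h3 : (lam * t) ^+ 2 <= r ^+ 2 by rewrite ler_pXn2r ?nnegrE ?(ltW r0) ?(ltW lt0).
    apply: (@le_trans _ _ ((m * e) ^+ 2 * (2 * t))).
      by rewrite (ler_wpM2l (sqr_ge0 _)).
    apply: (@le_trans _ _ (2 * m ^+ 2 / lam ^+ 2 * (e ^+ 2 / t) * (lam * t) ^+ 2)).
      rewrite le_eqVlt; apply/orP; left; apply/eqP; field.
      by rewrite !gt_eqF.
    rewrite ler_wpM2l// mulr_ge0//; last exact: divr_ge0 (sqr_ge0 _) (ltW tpos).
    exact: divr_ge0 (mulr_ge0 (ler0n _ 2) (sqr_ge0 _)) (sqr_ge0 _).
  have -> : Q = 2 * K1 ^+ 2 + 10 * (A ^+ 2 * e ^+ 2 / t) + 2 * m ^+ 2 / lam ^+ 2 * (e ^+ 2 / t).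
    by rewrite /Q /P -/A; ring.
  by clear -ha2 hb2 hv2; lra.
have := ler_norm (F t - F (lam * t)).
have hQ : Q * t = 2 * K1 ^+ 2 * t + P * e ^+ 2.
  by rewrite /Q mulrDl divfK// gt_eqF.
have hQ2 : Q * (t - lam * t) <= Q * t by rewrite ler_wpM2l//; lra_context.
have hK : 2 * K1 ^+ 2 * t <= eps / 2.
  move: teps; rewrite ltr_pdivlMr; last by rewrite mulr_gt0.
  by move=> h; have := sqr_ge0 K1; clear -h tpos; nra.
by move: hG e2; rewrite /G; clear -hQ hQ2 hK Phi_small; lra.
Qed.

(** * Directional derivatives *)

Section Directional.
Context {R : realType} {U : normedModType R}.
Implicit Types (f : U -> R) (x v w : U).

Lemma deriv_line f x v (s : R) : derivable f (x + s *: v) v ->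
  is_derive s 1 (fun t : R => f (x + t *: v)) ('D_v f (x + s *: v)).
Proof.
have E : (fun h : R => h^-1 *: (((fun t : R => f (x + t *: v)) \o shift s) (h *: 1) - f (x + s *: v)))
  = (fun h : R => h^-1 *: ((f \o shift (x + s *: v)) (h *: v) - f (x + s *: v))).
  apply/funext => h /=; congr (_ *: (f _ - _)).
  by rewrite [h%:A]mulr1 scalerDl addrCA.
by move=> fd; split; [rewrite /derivable E | rewrite /derive E].
Qed.

Lemma derive_scale f x v (k : R) : derivable f x v -> derivable f x (k *: v) ->
  'D_(k *: v) f x = k * 'D_v f x.
Proof.
move=> d1 d2.
have z0 : x + 0 *: (k *: v) = x by rewrite scale0r addr0.
have z1 : x + (k * 0) *: v = x by rewrite mulr0 scale0r addr0.
have H1 := @deriv_line f x (k *: v) 0; rewrite z0 in H1; have {}H1 := H1 d2.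
have H2 := @deriv_line f x v (k * 0); rewrite z1 in H2; have {}H2 := H2 d1.
have H3 := deriv_comp H2 (derivM (derivC k 0) (derivI 0)).
have E : (fun t : R => f (x + t *: (k *: v))) = (fun t => f (x + (k * t) *: v)).
  by apply/funext => t; rewrite scalerA mulrC.
rewrite E in H1.
by rewrite -(@derive_val _ _ _ _ _ _ _ H1) (@derive_val _ _ _ _ _ _ _ H3) mul0r add0r mulr1 mulrC.
Qed.

Lemma increment_bound f x v (L e h : R) : 0 <= h ->
  (forall s : R, 0 <= s <= h -> derivable f (x + s *: v) v) ->
  (forall s : R, 0 <= s <= h -> `|'D_v f (x + s *: v) - L| <= e) ->
  `|f (x + h *: v) - f x - h * L| <= h * e.
Proof.
move=> h0 fd fe.
have := @deriv_comparison R (fun s => f (x + s *: v) - s * L) (fun s => s * e)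
  (fun s => 'D_v f (x + s *: v) - L) (fun=> e) 0 h h0.
rewrite scale0r addr0 !mul0r !subr0 addrAC; apply=> s sh.
- refine (deriv_eq (derivB (deriv_line (fd s sh)) (derivM (derivI s) (derivC L s))) _).
  by rewrite mul1r mulr0 addr0.
- by refine (deriv_eq (derivM (derivI s) (derivC e s)) _); rewrite mul1r mulr0 addr0.
- exact: fe.
Qed.

Lemma near_segment (O : set U) x v w : nbhs x O ->
  \forall h \near (0 : R)^'+, forall s t : R, 0 <= s <= h -> 0 <= t <= h -> O (x + s *: v + t *: w).
Proof.
move=> /nbhs_ballP[e /= e0 He].
have n0 : 0 < `|v| + `|w| + 1 by rewrite ltr_wpDl// addr_ge0.
near=> h => s t /andP[s0 sh] /andP[t0 th].
apply: He; rewrite -ball_normE/=.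
rewrite -addrA opprD addNKr normrN.
apply: le_lt_trans (ler_normD _ _) _; rewrite !normrZ !ger0_norm//.
have h0 : 0 < h by near: h; exact: nbhs_right_gt.
have he : h < e / (`|v| + `|w| + 1).
  by near: h; apply: nbhs_right_lt; rewrite divr_gt0.
move: he; rewrite ltr_pdivlMr// => he.
have a1 : s * `|v| <= h * `|v| by rewrite ler_wpM2r.
have a2 : t * `|w| <= h * `|w| by rewrite ler_wpM2r.
by lra.
Unshelve. all: by end_near. Qed.

(* Both sides are limits of the second difference over [h^2], which is
   symmetric in [v] and [w]. *)
Lemma derive_commute (O : set U) f x v w : open O -> O x ->
  (forall y, O y -> derivable f y v) -> (forall y, O y -> derivable f y w) ->
  (forall y, O y -> derivable ('D_v f) y w) -> (forall y, O y -> derivable ('D_w f) y v) ->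
  {for x, continuous ('D_w ('D_v f))} -> {for x, continuous ('D_v ('D_w f))} ->
  'D_w ('D_v f) x = 'D_v ('D_w f) x.
Proof.
have main v' w' e : open O -> O x -> 0 < e ->
  (forall y, O y -> derivable f y v') -> (forall y, O y -> derivable ('D_v' f) y w') ->
  {for x, continuous ('D_w' ('D_v' f))} ->
  \forall h \near (0 : R)^'+, `|f (x + h *: w' + h *: v') - f (x + h *: v') - (f (x + h *: w') - f x)
     - h * (h * 'D_w' ('D_v' f) x)| <= h * (h * e).
  move=> oO Ox e0 dv dvw cwv.
  have /near_segment : nbhs x (O `&` [set y | `|'D_w' ('D_v' f) x - 'D_w' ('D_v' f) y| < e]).
    apply: filterI; first exact: open_nbhs_nbhs.
    by move/cvgrPdist_lt : cwv => /(_ e e0).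
  move=> /(_ v' w'); apply: filterS2 (nbhs_right_gt 0) => h h0 Hh.
  have hh : 0 <= h <= h by rewrite lexx ltW.
  pose g y := f (y + h *: w') - f y.
  (* The second difference is treated as a function of the step [s] along [v']: its derivative is an
     increment of ['D_v' f] over [h *: w'], which [increment_bound] compares with [h] times the
     mixed derivative. *)
  have gd s : 0 <= s <= h -> is_derive s 1 (fun s => f (x + h *: w' + s *: v') - f (x + s *: v') - s * (h * 'D_w' ('D_v' f) x))
    ('D_v' f (x + h *: w' + s *: v') - 'D_v' f (x + s *: v') - h * 'D_w' ('D_v' f) x).
    move=> sh.
    have O1 : O (x + h *: w' + s *: v') by rewrite addrAC; apply: (Hh _ _ sh hh).1.
    have O2 : O (x + s *: v').
      by have [] := Hh s 0 sh; rewrite ?lexx ?(ltW h0)// scale0r addr0.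
    refine (deriv_eq (derivB (derivB (deriv_line (dv _ O1)) (deriv_line (dv _ O2))) (derivM (derivI s) (derivC _ s))) _).
    by rewrite mul1r mulr0 addr0.
  have := @deriv_comparison R _ (fun s => s * (h * e)) _ (fun=> h * e) 0 h (ltW h0) gd.
  rewrite /= !scale0r !addr0 !mul0r !subr0 => HH.
  have -> : f (x + h *: w' + h *: v') - f (x + h *: v') - (f (x + h *: w') - f x)
     - h * (h * 'D_w' ('D_v' f) x) = f (x + h *: w' + h *: v') - f (x + h *: v') - h * (h * 'D_w' ('D_v' f) x) - (f (x + h *: w') - f x) by ring.
  apply: HH => s sh.
    by refine (deriv_eq (derivM (derivI s) (derivC _ s)) _); rewrite mul1r mulr0 addr0.
  have -> : x + h *: w' + s *: v' = x + s *: v' + h *: w' by rewrite addrAC.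
  apply: (@increment_bound ('D_v' f)) (ltW h0) _ _ => t th.
    by apply: dvw; exact: (Hh _ _ sh th).1.
  by rewrite distrC; apply: ltW; exact: (Hh _ _ sh th).2.
move=> oO Ox dv dw dvw dwv c1 c2.
apply/eqP; rewrite -subr_eq0 -normr_le0; apply/ler_addgt0Pr => e e0; rewrite add0r.
have e2 : 0 < e / 2 by rewrite divr_gt0.
have H1 := main v w _ oO Ox e2 dv dvw c1.
have H2 := main w v _ oO Ox e2 dw dwv c2.
have [h [h0 [h1 h2]]] := filter_ex (@filterI _ (0 : R)^'+ _ _ _ (nbhs_right_gt 0)
  (@filterI _ (0 : R)^'+ _ _ _ H1 H2)).
rewrite /= in h0.
have hh : 0 < h * h by rewrite mulr_gt0.
rewrite -(ler_pM2l hh) -[X in X * `|_|](gtr0_norm hh) -normrM.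
rewrite [x + h *: v + _]addrAC in h2.
move: h1 h2; move: (f (x + _ + _)) (f (x + h *: w)) (f (x + h *: v)) (f x) => A B D E.
move: ('D_w _ x) ('D_v _ x) => p q h1 h2.
have := ler_normB (A - B - (D - E) - h * (h * q)) (A - D - (B - E) - h * (h * p)).
have -> : A - B - (D - E) - h * (h * q) - (A - D - (B - E) - h * (h * p)) = h * h * (p - q) by ring.
lra.
Qed.

(** [Ck_on] provides directional derivatives, not a differential. The increment along [v + w] is
    split into a leg along [v] and a leg along [w]; the second starts at a moving point, which is
    where continuity of ['D_w f] enters. *)
Lemma deriv_add (O : set U) f x v w : open O -> O x ->
  (forall y, O y -> derivable f y v) -> (forall y, O y -> derivable f y w) ->
  derivable f x (v + w) -> {for x, continuous ('D_w f)} ->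
  'D_(v + w) f x = 'D_v f x + 'D_w f x.
Proof.
move=> oO Ox dv dw dvw cw.
apply/eqP; rewrite -subr_eq0 -normr_le0; apply/ler_addgt0Pr => e e0; rewrite add0r.
have e4 : 0 < e / 4 by rewrite divr_gt0.
have lim u : derivable f x u -> \forall h \near (0 : R)^'+, `|f (x + h *: u) - f x - h * 'D_u f x| <= h * (e / 4).
  move=> du.
  have : \forall h \near (0 : R)^', `|'D_u f x - h^-1 *: ((f \o shift x) (h *: u) - f x)| < e / 4.
    by have /cvgrPdist_lt := du; apply.
  rewrite !near_withinE; apply: filterS => h Hh h0.
  have {Hh}/ltW H := Hh (lt0r_neq0 h0).
  rewrite -(ler_pM2l h0) -{1}(gtr0_norm h0) -normrM in H.
  rewrite /= [h *: u + x]addrC in H.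
  have -> : f (x + h *: u) - f x - h * 'D_u f x = - (h * ('D_u f x - h^-1 *: (f (x + h *: u) - f x))).
    by rewrite mulrBr /GRing.scale /= mulrA divff ?gt_eqF// mul1r; ring.
  by rewrite normrN.
have H1 := lim _ (dv _ Ox); have H2 := lim _ dvw.
have Hn : nbhs x (O `&` [set y | `|'D_w f x - 'D_w f y| < e / 4]).
  apply: filterI; first exact: open_nbhs_nbhs.
  by move/cvgrPdist_lt : cw => /(_ _ e4).
have H3 := near_segment v w Hn.
have [h [h0 [h1 [h2 h3]]]] := filter_ex (@filterI _ (0 : R)^'+ _ _ _ (nbhs_right_gt 0)
  (@filterI _ (0 : R)^'+ _ _ _ H1 (@filterI _ (0 : R)^'+ _ _ _ H2 H3))).
rewrite /= in h0.
have hh : 0 <= h <= h by rewrite lexx ltW.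
have h4 : `|f (x + h *: v + h *: w) - f (x + h *: v) - h * 'D_w f x| <= h * (e / 4).
  apply: increment_bound (ltW h0) _ _ => s sh; have [Oy Ly] := h3 _ _ hh sh.
    exact: dw.
  by rewrite distrC ltW.
rewrite scalerDr addrA in h2.
rewrite -(ler_pM2l h0) -[X in X * `|_|](gtr0_norm h0) -normrM.
move: h1 h2 h4; move: (f (x + _ + _)) (f (x + h *: v)) (f x) => A B E.
move: ('D_(v + w) f x) ('D_v f x) ('D_w f x) => p q r h1 h2 h4.
rewrite !ler_norml in h1 h2 h4 *; lra.
Qed.

End Directional.

(** * The radial profile *)

(* [Gt] and [Gr] are the partial derivatives of [G], in the form of the chain
   rule along affine paths. *)
Definition path_deriv {R : realType} (G Gt Gr : R -> R -> R) : Prop :=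
  forall (tau rho : R -> R) (k l s : R),
  (forall z, tau z = tau 0 + k * z) -> (forall z, rho z = rho 0 + l * z) ->
  0 < tau s < 1 -> 0 < rho s ->
  is_derive s 1 (fun z => G (tau z) (rho z))
    (k * Gt (tau s) (rho s) + l * Gr (tau s) (rho s)).

Section Regularity.
Context {R : realType}.
Let W := (R * 'rV[R]_4)%type.

Definition axis_point (t r : R) : W := (t, r *: delta_mx 0 0).

Let et : W := (1, 0).
Let er : W := (0, delta_mx 0 0).

Lemma euclid_axis (r : R) : euclid (r *: (delta_mx 0 0 : 'rV[R]_4)) = `|r|.
Proof.
rewrite /euclid (bigD1 ord0)//= big1 => [|i /negPf i0].
  by rewrite addr0 !mxE !eqxx mulr1 sqrtr_sqr.
by rewrite !mxE i0 andbF mulr0 expr0n.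
Qed.

Lemma Ck_onS (O : set W) (f : W -> R) n (v : W) : Ck_on n.+1 O f ->
  (forall x, O x -> derivable f x v) /\ Ck_on n O ('D_v f).
Proof. by case=> _ /(_ v). Qed.

Lemma Ck_on_continuous (O : set W) (f : W -> R) n x : Ck_on n O f -> O x ->
  {for x, continuous f}.
Proof. by case: n => [|n] [cf _] Ox; apply: cf; rewrite inE. Qed.

Lemma axis_continuous (f : W -> R) (t r : R) :
  {for axis_point t r, continuous f} ->
  {for (t, r), continuous (fun p : R * R => f (axis_point p.1 p.2))}.
Proof.
move=> cf.
have c1 : {for (t, r), continuous (fun p : R * R => axis_point p.1 p.2)}.
  have c0 : {for (t, r), continuous (fun p : R * R => p.1)} by exact: cvg_fst.
  have c2 : {for (t, r), continuous (fun p : R * R => p.2)} by exact: cvg_snd.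
  have c3 : {for (t, r), continuous (fun p : R * R => p.2 *: (delta_mx 0 0 : 'rV[R]_4))}.
    have c4 : {for r, continuous (fun s : R => s *: (delta_mx 0 0 : 'rV[R]_4))}.
      exact: scalel_continuous.
    exact: (continuous_comp c2 c4).
  exact: (cvg_pair c0 c3).
exact: (continuous_comp c1 cf).
Qed.

(** Along affine paths the composite is [f] on a line of direction [k *: et + l *: er], so the chain
    rule is linearity of the directional derivative in the direction. *)
Lemma axis_path_deriv (O : set W) (f : W -> R) : open O ->
  (forall t r : R, 0 < t < 1 -> O (axis_point t r)) -> Ck_on 1 O f ->
  path_deriv (fun t r => f (axis_point t r))
    (fun t r => 'D_et f (axis_point t r)) (fun t r => 'D_er f (axis_point t r)).
Proof.
move=> oO Oaxis Cf tau rho k l s htau hrho t01 r0.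
have Cd v := Ck_onS v Cf.
pose w := k *: et + l *: er.
have Ez z : axis_point (tau z) (rho z) = axis_point (tau 0) (rho 0) + z *: w.
  rewrite /w /axis_point /et /er htau hrho; congr (_, _) => /=.
    by rewrite /GRing.scale /= mulr1 mulr0 addr0 mulrC.
  by rewrite scaler0 add0r scalerA scalerDl mulrC.
have Os : O (axis_point (tau 0) (rho 0) + s *: w) by rewrite -Ez; exact: Oaxis.
have H := deriv_line ((Cd w).1 _ Os).
have -> : (fun z => f (axis_point (tau z) (rho z))) = (fun z => f (axis_point (tau 0) (rho 0) + z *: w)).
  by apply/funext => z; rewrite Ez.
refine (deriv_eq H _); rewrite (Ez s).
have cr : {for axis_point (tau 0) (rho 0) + s *: w, continuous ('D_(l *: er) f)}.
  exact: Ck_on_continuous (Cd _).2 Os.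
have Hadd : 'D_w f (axis_point (tau 0) (rho 0) + s *: w) =
    'D_(k *: et) f (axis_point (tau 0) (rho 0) + s *: w) +
    'D_(l *: er) f (axis_point (tau 0) (rho 0) + s *: w).
  exact: (deriv_add oO Os (Cd _).1 (Cd _).1 ((Cd _).1 _ Os) cr).
rewrite Hadd (derive_scale ((Cd et).1 _ Os) ((Cd (k *: et)).1 _ Os)).
by rewrite (derive_scale ((Cd er).1 _ Os) ((Cd (l *: er)).1 _ Os)).
Qed.

Lemma derive_affine_id (G Gt Gr : R -> R -> R) (t r : R) : path_deriv G Gt Gr ->
  0 < t < 1 -> 0 < r ->
  is_derive t 1 (G ^~ r) (Gt t r) /\ is_derive r 1 (G t) (Gr t r).
Proof.
move=> HG t01 r0; split.
  have := HG id (fun=> r) 1 0 t; rewrite mul1r mul0r addr0; apply => // z.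
    by rewrite add0r mul1r.
  by rewrite mul0r addr0.
have := HG (fun=> t) id 0 1 r; rewrite mul1r mul0r add0r; apply => // z.
  by rewrite mul0r addr0.
by rewrite add0r mul1r.
Qed.

(** The values of [u] at negative radii are arbitrary. [U t r] is the lift on a line through the
    axis, that is [u t |r|]: it agrees with [u] for [r >= 0], and its derivatives come from those of
    the lift. *)
Lemma profile_regularity (J : set R) (u : R -> R -> R) :
  (forall t : R, 0 < t < 1 -> J t) ->
  smooth_on (J `*` [set: 'rV[R]_4]) (spacetime_lift u) ->
  exists U Ut Ur Utt Utr Urr : R -> R -> R,
   [/\ path_deriv U Ut Ur, path_deriv Ut Utt Utr, path_deriv Ur Utr Urr,
     forall t r : R, 0 < t < 1 -> 0 < r ->
      [/\ {for (t, r), continuous (fun p : R * R => U p.1 p.2)},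
          {for (t, r), continuous (fun p : R * R => Ut p.1 p.2)} &
          {for (t, r), continuous (fun p : R * R => Ur p.1 p.2)}] &
     forall t r : R, 0 < t < 1 -> 0 < r ->
      [/\ u t r = U t r, dt u t r = Ut t r, dr u t r = Ur t r,
          dtt u t r = Utt t r & drr u t r = Urr t r]].
Proof.
move=> J01 [dom [dom_open Jdom smooth]].
pose F := spacetime_lift u.
have dom_axis t r : 0 < t < 1 -> dom (axis_point t r).
  by move=> /J01 Jt; apply: Jdom.
have C2 : Ck_on 2 dom F by exact: smooth.
pose U t r := F (axis_point t r).
pose Ut t r := 'D_et F (axis_point t r).
pose Ur t r := 'D_er F (axis_point t r).
have C1 : Ck_on 1 dom F by exact: smooth.
have Ck1 v : Ck_on 1 dom ('D_v F) by exact: (Ck_onS v C2).2.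
have HU : path_deriv U Ut Ur by exact: (axis_path_deriv dom_open dom_axis C1).
have HUt := axis_path_deriv dom_open dom_axis (Ck1 et).
have HUr := axis_path_deriv dom_open dom_axis (Ck1 er).
have comm t r : 0 < t < 1 -> 'D_er ('D_et F) (axis_point t r) = 'D_et ('D_er F) (axis_point t r).
  move=> t01; have Ox := dom_axis t r t01.
  apply: (derive_commute dom_open Ox).
  - exact: (Ck_onS et C1).1.
  - exact: (Ck_onS er C1).1.
  - exact: (Ck_onS er (Ck1 et)).1.
  - exact: (Ck_onS et (Ck1 er)).1.
  - exact: Ck_on_continuous (Ck_onS er (Ck1 et)).2 Ox.
  - exact: Ck_on_continuous (Ck_onS et (Ck1 er)).2 Ox.
exists U, Ut, Ur, (fun t r => 'D_et ('D_et F) (axis_point t r)),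
  (fun t r => 'D_er ('D_et F) (axis_point t r)), (fun t r => 'D_er ('D_er F) (axis_point t r)).
(* The same [Utr] serves both first derivatives, so that the mixed derivatives cancel in [V_xy]. *)
have HUr' : path_deriv Ur (fun t r => 'D_er ('D_et F) (axis_point t r)) (fun t r => 'D_er ('D_er F) (axis_point t r)).
  move=> tau rho k l s h1 h2 h3 h4; refine (deriv_eq (HUr tau rho k l s h1 h2 h3 h4) _).
  exact: (congr1 (fun z => k * z + l * _) (esym (comm (tau s) (rho s) h3))).
have uU t r : 0 <= r -> u t r = U t r.
  by move=> r0; rewrite /U /F /spacetime_lift /= euclid_axis ger0_norm.
have near_t (t : R) : 0 < t < 1 -> \forall s \near t, 0 < s < 1.
  move=> /andP[t0 t1]; near=> s; apply/andP; split; near: s; [exact: lt_nbhsr|exact: lt_nbhsl].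
have near_r (r : R) : 0 < r -> \forall s \near r, 0 < s by move=> r0; exact: lt_nbhsr.
have Ht t r : 0 < t < 1 -> 0 < r -> dt u t r = Ut t r.
  move=> t01 r0; rewrite /dt derive1E; apply: derive_val.
  have -> : u ^~ r = U ^~ r by apply/funext => s; rewrite uU// ltW.
  exact: (derive_affine_id HU t01 r0).1.
have Hr t r : 0 < t < 1 -> 0 < r -> dr u t r = Ur t r.
  move=> t01 r0; rewrite /dr derive1E; apply: derive_val.
  apply: near_eq_is_derive (derive_affine_id HU t01 r0).2.
  by apply: filterS (near_r r r0) => s s0; rewrite uU// ltW.
split; [exact: HU | exact: HUt | exact: HUr' | move=> t r t01 r0 | move=> t r t01 r0].
  have Ox := dom_axis t r t01; split.
  - exact: axis_continuous (Ck_on_continuous C1 Ox).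
  - exact: axis_continuous (Ck_on_continuous (Ck1 et) Ox).
  - exact: axis_continuous (Ck_on_continuous (Ck1 er) Ox).
split; [exact: uU (ltW r0) | exact: Ht | exact: Hr | |].
- rewrite /dtt /derive1n /= derive1E; apply: derive_val.
  apply: near_eq_is_derive (derive_affine_id HUt t01 r0).1.
  by apply: filterS (near_t t t01) => s s01; rewrite -/(Ut s r) -Ht.
- rewrite /drr /derive1n /= derive1E; apply: derive_val.
  apply: near_eq_is_derive (derive_affine_id HUr' t01 r0).2.
  by apply: filterS (near_r r r0) => s s01; rewrite -Hr.
Unshelve. all: by end_near. Qed.

End Regularity.

(** * Bounds drawn from the energy norm *)

Lemma primitive_le_integral {R : realType} (f F : R -> R) (M r1 r2 : R) :
  (forall r : R, 0 < r -> 0 <= f r) -> (forall r : R, 0 < r -> {for r, continuous f}) ->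
  (\int[@lebesgue_measure R]_(r in `]0%R, +oo[) (f r)%:E <= M%:E)%E ->
  0 < r1 -> r1 <= r2 -> (forall r : R, r1 <= r <= r2 -> is_derive r 1 F (f r)) ->
  F r2 - F r1 <= M.
Proof.
move=> f0 cf fM r10 r12 dF.
have fge : forall r : R, `]0%R, +oo[%classic r -> (0 <= (f r)%:E)%E.
  by move=> r /=; rewrite in_itv/= andbT lee_fin; exact: f0.
move: r12; rewrite le_eqVlt => /predU1P[<-|r12].
  rewrite subrr -lee_fin; apply: le_trans fM; exact: integral_ge0.
have cf12 (x : R) : r1 <= x <= r2 -> {for x, continuous f}.
  by move=> /andP[x1 _]; apply: cf; exact: lt_le_trans x1.
rewrite -lee_fin -(integral_primitive r12 cf12 dF).
apply: le_trans fM; apply: ge0_subset_integral => //.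
- apply/measurable_EFinP; apply: open_continuous_measurable_fun; first exact: interval_open.
  by move=> x; rewrite inE/= in_itv/= andbT; exact: cf.
- by move=> x /=; rewrite !in_itv/= andbT => /andP[x1 _]; exact: lt_le_trans x1.
Qed.

Lemma poweR_half_le {R : realType} (x : \bar R) (s : R) :
  (0 <= x)%E -> (poweR x 2^-1 <= s%:E)%E -> (x <= (s ^+ 2)%:E)%E.
Proof.
case: x => [x| |]//; last by rewrite poweRyr ?invr_neq0.
rewrite !lee_fin => x0; rewrite powR12_sqrt// => xs.
have s0 : 0 <= s by apply: le_trans xs; exact: sqrtr_ge0.
by rewrite -(sqr_sqrtr x0) ler_pXn2r ?nnegrE ?sqrtr_ge0.
Qed.

Lemma radial_int_ge0 {R : realType} (f : R -> R) :
  (forall r, 0 <= f r) -> (0 <= radial_int f)%E.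
Proof.
move=> f0; apply: integral_ge0 => r /=; rewrite in_itv/= andbT lee_fin => r0.
by rewrite mulr_ge0// exprn_ge0// ltW.
Qed.

Lemma energy_uniform {R : realType} (J : set R) (u : R -> R -> R) :
  (ereal_sup [set H_norm (u t) (dt u t) | t in J] < +oo)%E ->
  exists2 M : R, 0 <= M & forall t, J t ->
    (radial_int (fun r => dr u t r ^+ 2 + dt u t r ^+ 2)%R <= M%:E)%E.
Proof.
move=> hb.
have [s hs] : exists s : R, forall t, J t -> (H_norm (u t) (dt u t) <= s%:E)%E.
  (* The maximum with 0 keeps the value finite when [J] is empty and the supremum is [-oo]. *)
  exists (fine (maxe 0%E (ereal_sup [set H_norm (u t) (dt u t) | t in J]))) => t Jt.
  rewrite fineK.
    by rewrite le_max; apply/orP; right; apply: ereal_sup_ubound; exists t.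
  rewrite ge0_fin_numE ?le_max ?lexx//.
  by rewrite gt_max ltry.
exists (s ^+ 2) => [|t Jt]; first exact: sqr_ge0.
apply: poweR_half_le; last exact: hs.
by apply: radial_int_ge0 => r; rewrite addr_ge0 ?sqr_ge0.
Qed.

(* Finite [L^4] norm rules out a nonzero limit at infinity. *)
Lemma radial_decay {R : realType} (f df : R -> R) (M : R) : 0 <= M ->
  (forall r : R, 0 < r -> is_derive r 1 f (df r)) ->
  (forall r : R, 0 < r -> {for r, continuous df}) ->
  (forall (E : R -> R) (r1 r2 : R), 0 < r1 -> r1 <= r2 ->
    (forall r : R, r1 <= r <= r2 -> is_derive r 1 E (df r ^+ 2 * r ^+ 3)) ->
    E r2 - E r1 <= M) ->
  (radial_int (fun r => f r ^+ 4)%R < +oo)%E ->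
  forall r : R, 0 < r -> `|f r| * r <= M + 1.
Proof.
move=> M0 dfd cdf HE Hf r r0; rewrite leNgt; apply/negP => hr.
(* By contradiction [|f r| > 2 c], while beyond [r] the value of [f] moves by at most [c]; so
   [|f| >= c] there. *)
pose c := (M + 1) / (2 * r).
have c0 : 0 < c by rewrite divr_gt0 ?mulr_gt0//; lra.
have cX (n : nat) (s : R) : {for s, continuous (fun s : R => s ^+ n)}.
  exact: exprn_continuous.
have lower (s : R) : r <= s -> c <= `|f s|.
  move=> rs.
  have [||E [_ dE]] := @primitive_exists R (fun s => df s ^+ 2 * s ^+ 3) (r / 2) (s + 1).
  - lra.
  - move=> x /andP[xr _]; apply: cvgM; last exact: cX.
    have cx : {for x, continuous df} by apply: cdf; lra.
    exact: (cvgM cx cx).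
  have hE : E s - E r <= M by apply: HE => // x xrs; apply: dE; lra_context.
  (* Cauchy-Schwarz in the form [|f'| <= (f'^2 x^3 / r + r / x^3) / 2]; [r / x^3] integrates to at
     most [1 / (2 r)]. *)
  pose F x := (r^-1 * E x - r / (2 * x ^+ 2)) / 2.
  have hF : `|f s - f r| <= F s - F r.
    apply: (@deriv_comparison R f F df (fun x => (r^-1 * (df x ^+ 2 * x ^+ 3) + (r^-1 * x ^+ 3)^-1) / 2))
      => [//|x /andP[x1 x2]|x /andP[x1 x2]|x /andP[x1 x2]].
    - by apply: dfd; lra.
    - have x0 : 0 < x by lra.
      have dEx : is_derive x 1 E (df x ^+ 2 * x ^+ 3) by apply: dE; lra_context.
      have n0 : 2 * x ^+ 2 != 0 by rewrite mulf_neq0// expf_neq0// gt_eqF.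
      have dX := derivM (derivC 2 x) (derivX 1 (derivI x)).
      have dV := @derivV R (fun x => 2 * x ^+ 2) x _ n0 dX.
      refine (deriv_eq (derivM (derivB (derivM (derivC r^-1 x) dEx) (derivM (derivC r x) dV)) (derivC 2^-1 x)) _).
      by field; rewrite !gt_eqF.
    - have x0 : 0 < x by lra.
      by apply: young_abs; [rewrite invr_gt0 | rewrite exprn_gt0].
  have h1 : F s - F r <= (M / r + 1 / (2 * r)) / 2.
    have : 0 <= r / (2 * s ^+ 2).
      by rewrite divr_ge0 ?(ltW r0)// mulr_ge0// sqr_ge0.
    have : r^-1 * (E s - E r) <= M / r.
      by rewrite mulrC ler_wpM2r// invr_ge0 ltW.
    have E1 : r / (2 * r ^+ 2) = 1 / (2 * r) by field; rewrite gt_eqF.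
    by rewrite /F E1; lra.
  have h2 : (M / r + 1 / (2 * r)) / 2 <= c.
    rewrite /c.
    have -> : (M / r + 1 / (2 * r)) / 2 = (M + 1 / 2) / (2 * r) by field; rewrite gt_eqF.
    by rewrite ler_pM2r ?invr_gt0 ?mulr_gt0//; lra.
  have h3 : 2 * c < `|f r|.
    have -> : 2 * c = (M + 1) / r by rewrite /c; field; rewrite gt_eqF.
    by rewrite ltr_pdivrMr.
  have := ler_normB (f s) (f s - f r).
  have -> : f s - (f s - f r) = f r by ring.
  lra.
have f4 (s : R) : 0 <= f s ^+ 4 by rewrite exprn_even_ge0.
have I0 := radial_int_ge0 f4.
pose I := fine (radial_int (fun r => f r ^+ 4)).
have HI : (radial_int (fun r => f r ^+ 4)%R <= I%:E)%E by rewrite /I fineK// ge0_fin_numE.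
have ch (x : R) : 0 < x -> {for x, continuous (fun x => f x ^+ 4 * x ^+ 3)}.
  move=> x0; have cf := deriv_cts (dfd x x0).
  apply: cvgM; last exact: cX.
  exact: (continuous_comp cf (cX 4%N _)).
have k0 : 0 < c ^+ 4 * r ^+ 3 by rewrite mulr_gt0 ?exprn_gt0.
(* A length over which the lower bound [c^4 r^3] for the integrand accumulates [I + 1], more than
   the whole integral. *)
pose n := (I + 1) / (c ^+ 4 * r ^+ 3).
have I1 : 0 <= I by rewrite -lee_fin /I fineK// ge0_fin_numE.
have n0 : 0 <= n by rewrite divr_ge0 ?(ltW k0)//; lra.
have [||Q [_ dQ]] := @primitive_exists R (fun s => f s ^+ 4 * s ^+ 3) (r / 2) (r + n + 1).
- lra.
- by move=> x /andP[xr _]; apply: ch; lra.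
have hQ : Q (r + n) - Q r <= I.
  apply: (@primitive_le_integral R (fun s => f s ^+ 4 * s ^+ 3)) => //.
  - by move=> s s0; rewrite mulr_ge0// exprn_ge0// ltW.
  - lra.
  - by move=> s sr; apply: dQ; lra_context.
have : Q r - c ^+ 4 * r ^+ 3 * r <= Q (r + n) - c ^+ 4 * r ^+ 3 * (r + n).
  apply: (@ndecr_of_deriv R (fun s => Q s - c ^+ 4 * r ^+ 3 * s) (fun s => f s ^+ 4 * s ^+ 3 - c ^+ 4 * r ^+ 3)).
  - lra.
  - move=> s sr; have dQs : is_derive s 1 Q (f s ^+ 4 * s ^+ 3) by apply: dQ; lra_context.
    refine (deriv_eq (derivB dQs (derivM (derivC _ s) (derivI s))) _).
    by rewrite mul0r add0r mulr1.
  - move=> s /andP[rs _]; rewrite subr_ge0.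
    have -> : f s ^+ 4 = `|f s| ^+ 4.
      by rewrite !(exprM _ 2 2) real_normK ?num_real.
    rewrite ler_pM ?exprn_ge0// ?(ltW c0) ?(ltW r0)//.
      by rewrite ler_pXn2r ?nnegrE ?(ltW c0)//; exact: lower.
    by rewrite ler_pXn2r ?nnegrE//; lra.
have -> : c ^+ 4 * r ^+ 3 * (r + n) = c ^+ 4 * r ^+ 3 * r + (I + 1).
  by rewrite mulrDr /n [X in _ + X]mulrC divfK// gt_eqF.
lra.
Qed.

(** * The equation for [r^(3/2) u] *)

Section CharacteristicProfile.
Context {R : realType}.
Implicit Types U Ut Ur Utt Utr Urr G Gt Gr : R -> R -> R.

Definition char_time (x y : R) := 1 - (x + y) / 2.
Definition char_radius (x y : R) := (y - x) / 2.

(** The exponent 3/2 removes the first-order term [3 / r u_r] and leaves the potential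
    [3 / (4 r^2)]. It is written as a cubed square root, so that all identities become rational in
    [w] with [r = w^2]. *)
Definition char_V U x y :=
  Num.sqrt (char_radius x y) ^+ 3 * U (char_time x y) (char_radius x y).

Definition char_a U Ut Ur x y :=
  - (1 / 2) * (Num.sqrt (char_radius x y) ^+ 3 *
     (Ut (char_time x y) (char_radius x y) + Ur (char_time x y) (char_radius x y)) +
   3 / 2 * (Num.sqrt (char_radius x y) * U (char_time x y) (char_radius x y))).

Definition char_b U Ut Ur x y :=
  - (1 / 2) * (Num.sqrt (char_radius x y) ^+ 3 *
     (Ut (char_time x y) (char_radius x y) - Ur (char_time x y) (char_radius x y)) -
   3 / 2 * (Num.sqrt (char_radius x y) * U (char_time x y) (char_radius x y))).

Definition char_g U x y :=
  (Num.sqrt (char_radius x y) ^+ 3 * U (char_time x y) (char_radius x y) ^+ 3 -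
   3 / 4 * (U (char_time x y) (char_radius x y) / Num.sqrt (char_radius x y))) / 4.

Lemma path_derivD G Gt Gr U Ut Ur : path_deriv G Gt Gr -> path_deriv U Ut Ur ->
  path_deriv (fun t r => G t r + U t r) (fun t r => Gt t r + Ut t r) (fun t r => Gr t r + Ur t r).
Proof.
move=> HG HU tau rho k l s h1 h2 h3 h4.
by refine (deriv_eq (derivD (HG _ _ _ _ _ h1 h2 h3 h4) (HU _ _ _ _ _ h1 h2 h3 h4)) _); ring.
Qed.

Lemma path_derivB G Gt Gr U Ut Ur : path_deriv G Gt Gr -> path_deriv U Ut Ur ->
  path_deriv (fun t r => G t r - U t r) (fun t r => Gt t r - Ut t r) (fun t r => Gr t r - Ur t r).
Proof.
move=> HG HU tau rho k l s h1 h2 h3 h4.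
by refine (deriv_eq (derivB (HG _ _ _ _ _ h1 h2 h3 h4) (HU _ _ _ _ _ h1 h2 h3 h4)) _); ring.
Qed.

Lemma path_sqrt (rho : R -> R) (l s : R) : (forall z, rho z = rho 0 + l * z) -> 0 < rho s ->
  is_derive s 1 (fun z => Num.sqrt (rho z)) (l / (2 * Num.sqrt (rho s))).
Proof.
move=> h r0; have dr : is_derive s 1 rho l.
  have -> : rho = (fun z => rho 0 + l * z) by apply/funext.
  by refine (deriv_eq (derivD (derivC _ s) (derivM (derivC l s) (derivI s))) _); ring.
exact: deriv_sqrt.
Qed.

Lemma path_weight1 G Gt Gr (tau rho : R -> R) (k l s : R) : path_deriv G Gt Gr ->
  (forall z, tau z = tau 0 + k * z) -> (forall z, rho z = rho 0 + l * z) ->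
  0 < tau s < 1 -> 0 < rho s ->
  is_derive s 1 (fun z => Num.sqrt (rho z) * G (tau z) (rho z))
    (Num.sqrt (rho s) * (k * Gt (tau s) (rho s) + l * Gr (tau s) (rho s)) +
     l / 2 * (G (tau s) (rho s) / Num.sqrt (rho s))).
Proof.
move=> HG h1 h2 h3 h4.
have s0 : Num.sqrt (rho s) != 0 by rewrite gt_eqF// sqrtr_gt0.
by refine (deriv_eq (derivM (path_sqrt h2 h4) (HG _ _ _ _ _ h1 h2 h3 h4)) _); field.
Qed.

Lemma path_weight3 G Gt Gr (tau rho : R -> R) (k l s : R) : path_deriv G Gt Gr ->
  (forall z, tau z = tau 0 + k * z) -> (forall z, rho z = rho 0 + l * z) ->
  0 < tau s < 1 -> 0 < rho s ->
  is_derive s 1 (fun z => Num.sqrt (rho z) ^+ 3 * G (tau z) (rho z))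
    (Num.sqrt (rho s) ^+ 3 * (k * Gt (tau s) (rho s) + l * Gr (tau s) (rho s)) +
     3 / 2 * l * (Num.sqrt (rho s) * G (tau s) (rho s))).
Proof.
move=> HG h1 h2 h3 h4.
have s0 : Num.sqrt (rho s) != 0 by rewrite gt_eqF// sqrtr_gt0.
by refine (deriv_eq (derivM (derivX 2 (path_sqrt h2 h4)) (HG _ _ _ _ _ h1 h2 h3 h4)) _); field.
Qed.

Lemma char_domain (x y : R) : x < y -> 0 < x + y < 2 ->
  0 < char_time x y < 1 /\ 0 < char_radius x y.
Proof.
move=> xy /andP[h1 h2]; rewrite /char_time /char_radius; split; last lra.
by apply/andP; split; lra.
Qed.

Lemma char_time_slice (t r : R) : char_time (t - r) (t + r) = 1 - t.
Proof. by rewrite /char_time; field. Qed.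

Lemma char_radius_slice (t r : R) : char_radius (t - r) (t + r) = r.
Proof. by rewrite /char_radius; field. Qed.

Lemma char_comp_continuous G (x y : R) :
  {for (char_time x y, char_radius x y), continuous (fun p : R * R => G p.1 p.2)} ->
  {for (x, y), continuous (fun p : R * R => G (char_time p.1 p.2) (char_radius p.1 p.2))}.
Proof.
move=> cG.
have c1 : {for (x, y), continuous (fun p : R * R => p.1)} by exact: cvg_fst.
have c2 : {for (x, y), continuous (fun p : R * R => p.2)} by exact: cvg_snd.
have ct : {for (x, y), continuous (fun p : R * R => char_time p.1 p.2)}.
  by apply: cvgB; [exact: cvg_cst | apply: cvgM; [exact: cvgD c1 c2 | exact: cvg_cst]].
have cr : {for (x, y), continuous (fun p : R * R => char_radius p.1 p.2)}.
  by apply: cvgM; [exact: cvgB c2 c1 | exact: cvg_cst].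
have c : {for (x, y), continuous (fun p : R * R => (char_time p.1 p.2, char_radius p.1 p.2))}.
  exact: (cvg_pair ct cr).
exact: (continuous_comp c cG).
Qed.

Lemma char_sqrt_continuous (x y : R) :
  {for (x, y), continuous (fun p : R * R => Num.sqrt (char_radius p.1 p.2))}.
Proof.
apply: (@char_comp_continuous (fun _ r => Num.sqrt r)).
have c2 : {for (char_time x y, char_radius x y), continuous (fun p : R * R => p.2)} by exact: cvg_snd.
exact: (continuous_comp c2 (@sqrt_continuous R _)).
Qed.

(** One constant serves three bounds: [K^2] for [V_xy], [K] for [V], and [4 M + 9 / 4 K^2] for the
    slice energy, whose second term is the boundary term of Hardy's inequality. *)
Lemma char_wave_profile U Ut Ur Utt Utr Urr (M K : R) :
  0 <= M -> 1 <= K ->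
  path_deriv U Ut Ur -> path_deriv Ut Utt Utr -> path_deriv Ur Utr Urr ->
  (forall t r : R, 0 < t < 1 -> 0 < r ->
      [/\ {for (t, r), continuous (fun p : R * R => U p.1 p.2)},
          {for (t, r), continuous (fun p : R * R => Ut p.1 p.2)} &
          {for (t, r), continuous (fun p : R * R => Ur p.1 p.2)}]) ->
  (forall t r : R, 0 < t < 1 -> 0 < r ->
     Utt t r - Urr t r - 3 / r * Ur t r - U t r ^+ 3 = 0) ->
  (forall t r : R, 0 < t < 1 -> 0 < r -> `|U t r| * r <= K) ->
  (forall (t : R) (E : R -> R) (r1 r2 : R), 0 < t < 1 -> 0 < r1 -> r1 <= r2 ->
    (forall r : R, r1 <= r <= r2 -> is_derive r 1 E ((Ur t r ^+ 2 + Ut t r ^+ 2) * r ^+ 3)) ->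
    E r2 - E r1 <= M) ->
  char_wave (4 * M + 4 * K ^+ 2) (char_V U) (char_a U Ut Ur) (char_b U Ut Ur) (char_g U).
Proof.
move=> M0 K1 HU HUt HUr cU eqU HK HE.
have K2 : 1 <= K ^+ 2 by rewrite expr2 mulr_ege1.
have KK : K <= K ^+ 2 by rewrite expr2 ler_peMr//; lra.
have cUU (x y : R) : x < y -> 0 < x + y < 2 ->
   [/\ {for (x, y), continuous (fun p : R * R => U (char_time p.1 p.2) (char_radius p.1 p.2))},
       {for (x, y), continuous (fun p : R * R => Ut (char_time p.1 p.2) (char_radius p.1 p.2))} &
       {for (x, y), continuous (fun p : R * R => Ur (char_time p.1 p.2) (char_radius p.1 p.2))}].
  move=> xy xy2; have [t01 r0] := char_domain xy xy2.
  by have [h1 h2 h3] := cU _ _ t01 r0; split; apply: char_comp_continuous.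
have cs3 (x y : R) : {for (x, y), continuous (fun p : R * R => Num.sqrt (char_radius p.1 p.2) ^+ 3)}.
  exact: (continuous_comp (@char_sqrt_continuous x y) (@exprn_continuous _ 3%N _)).
have tx (y : R) z : char_time z y = char_time 0 y + - (1 / 2) * z by rewrite /char_time; field.
have ty (x : R) z : char_time x z = char_time x 0 + - (1 / 2) * z by rewrite /char_time; field.
have rx (y : R) z : char_radius z y = char_radius 0 y + - (1 / 2) * z by rewrite /char_radius; field.
have ry (x : R) z : char_radius x z = char_radius x 0 + (1 / 2) * z by rewrite /char_radius; field.
have wave (w r u3 ur utt urr : R) : 0 < w -> r = w ^+ 2 -> utt - urr - 3 / r * ur - u3 = 0 ->
    w ^+ 3 * (utt - urr) - 3 * w * ur = w ^+ 3 * u3.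
  move=> w0 -> E; have -> : u3 = utt - urr - 3 / w ^+ 2 * ur by lra.
  by field; rewrite gt_eqF.
have fin (x y : R) : x < y -> 0 < x + y < 2 ->
  let w := Num.sqrt (char_radius x y) in let t := char_time x y in let r := char_radius x y in
  [/\ 0 < w, r = w ^+ 2 & w ^+ 3 * (Utt t r - Urr t r) - 3 * w * Ur t r = w ^+ 3 * U t r ^+ 3].
  move=> xy xy2 /=; have [t01 r0] := char_domain xy xy2.
  have w0 : 0 < Num.sqrt (char_radius x y) by rewrite sqrtr_gt0.
  have E : char_radius x y = Num.sqrt (char_radius x y) ^+ 2 by rewrite sqr_sqrtr// ltW.
  by split => //; apply: (wave _ _ _ _ _ _ w0 E); exact: eqU.
split.
- lra.
- move=> x y xy xy2; have [t01 r0] := char_domain xy xy2.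
  refine (deriv_eq (path_weight3 HU (tx y) (rx y) t01 r0) _).
  by rewrite /char_a; ring.
- move=> x y xy xy2; have [t01 r0] := char_domain xy xy2.
  refine (deriv_eq (path_weight3 HU (ty x) (ry x) t01 r0) _).
  by rewrite /char_b; ring.
- move=> t r t01 r0.
  have t01' : 0 < 1 - t < 1 by lra_context.
  have E : (fun r => char_V U (t - r) (t + r)) = (fun r => Num.sqrt r ^+ 3 * U (1 - t) r).
    by apply/funext => z; rewrite /char_V char_time_slice char_radius_slice.
  rewrite E.
  have h1 (z : R) : 1 - t = 1 - t + 0 * z by rewrite mul0r addr0.
  have h2 (z : R) : z = 0 + 1 * z by rewrite add0r mul1r.
  refine (deriv_eq (@path_weight3 U Ut Ur (fun=> 1 - t) id 0 1 r HU h1 h2 t01' r0) _).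
  by rewrite /char_a /char_b char_time_slice char_radius_slice; field.
- move=> x y xy xy2; have [t01 r0] := char_domain xy xy2.
  have [w0 Er Ew] := fin x y xy xy2.
  refine (deriv_eq (derivM (derivC _ y) (derivD (path_weight3 (path_derivD HUt HUr) (ty x) (ry x) t01 r0)
    (derivM (derivC (3 / 2) y) (path_weight1 HU (ty x) (ry x) t01 r0)))) _).
  rewrite /char_g -Ew; field; rewrite gt_eqF//.
- move=> x y xy xy2; have [t01 r0] := char_domain xy xy2.
  have [w0 Er Ew] := fin x y xy xy2.
  refine (deriv_eq (derivM (derivC _ x) (derivB (path_weight3 (path_derivB HUt HUr) (tx y) (rx y) t01 r0)
    (derivM (derivC (3 / 2) x) (path_weight1 HU (tx y) (rx y) t01 r0)))) _).
  rewrite /char_g -Ew; field; rewrite gt_eqF//.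
- move=> x y xy xy2; have [t01 r0] := char_domain xy xy2.
  have [w0 Er Ew] := fin x y xy xy2.
  have Hk := HK _ _ t01 r0.
  have yx : (y - x) ^+ 2 = 4 * char_radius x y ^+ 2 by rewrite /char_radius; field.
  rewrite yx; clear yx; rewrite /char_g /char_V.
  suff aux (w r v : R) : 0 < w -> 0 < r -> r = w ^+ 2 -> `|v| * r <= K ->
    `|(w ^+ 3 * v ^+ 3 - 3 / 4 * (v / w)) / 4| <=
    (4 * M + 4 * K ^+ 2) * `|w ^+ 3 * v| / (4 * r ^+ 2) by exact: aux.
  move: M0 K1 K2 => {}M0 {}K1 {}K2 {}w0 {}r0 {}Er Hv.
  (* The cubic term becomes a potential: the bracket is bounded because [v r] is, and
     [4 r^2 = (y - x)^2]. *)
  have -> : (w ^+ 3 * v ^+ 3 - 3 / 4 * (v / w)) / 4 = w ^+ 3 * v / (4 * r ^+ 2) * ((v * r) ^+ 2 - 3 / 4).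
    by rewrite Er; field; rewrite gt_eqF.
  have r4 : 0 < 4 * r ^+ 2 by rewrite mulr_gt0// exprn_gt0.
  have E2 : `|w ^+ 3 * v / (4 * r ^+ 2)| = `|w ^+ 3 * v| / (4 * r ^+ 2).
    by rewrite [LHS]normrM normfV (gtr0_norm r4).
  rewrite [leLHS]normrM E2 mulrC mulrA ler_wpM2r ?invr_ge0 ?(ltW r4)//.
  rewrite ler_wpM2r//.
  have Hv2 : (v * r) ^+ 2 <= K ^+ 2.
    rewrite -[in leLHS]real_normK ?num_real// normrM (gtr0_norm r0).
    by rewrite ler_pXn2r ?nnegrE ?mulr_ge0 ?(ltW r0)//; lra.
  have := sqr_ge0 (v * r); rewrite ler_norml => vr0.
  apply/andP; split; lra.
- move=> x y xy xy2; have [t01 r0] := char_domain xy xy2.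
  have [w0 Er _] := fin x y xy xy2.
  have Hk := HK _ _ t01 r0.
  rewrite /char_V normrM (gtr0_norm (exprn_gt0 3 w0)).
  have -> : Num.sqrt (char_radius x y) ^+ 3 * `|U (char_time x y) (char_radius x y)|
    = `|U (char_time x y) (char_radius x y)| * char_radius x y * Num.sqrt (char_radius x y).
    by rewrite [X in _ * X * _]Er; ring.
  apply: ler_pM => //; first by rewrite mulr_ge0// ltW.
    lra.
  by rewrite ler_wsqrtr// /char_radius; lra.
- move=> x y xy xy2; have [h1 h2 h3] := cUU x y xy xy2.
  apply: cvgM; first exact: cvg_cst.
  apply: cvgD; first exact: cvgM (@cs3 x y) (cvgD h2 h3).
  apply: cvgM; first exact: cvg_cst.
  exact: cvgM (@char_sqrt_continuous x y) h1.
- move=> x y xy xy2; have [h1 h2 h3] := cUU x y xy xy2.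
  apply: cvgM; first exact: cvg_cst.
  apply: cvgB; first exact: cvgM (@cs3 x y) (cvgB h2 h3).
  apply: cvgM; first exact: cvg_cst.
  exact: cvgM (@char_sqrt_continuous x y) h1.
- move=> t r1 r2 H t01 r10 r12 dH.
  have t01' : 0 < 1 - t < 1 by move/andP: t01 => [t0 t1]; apply/andP; split; lra.
  pose f r := (Ur (1 - t) r ^+ 2 + Ut (1 - t) r ^+ 2) * r ^+ 3.
  have cf r : 0 < r -> {for r, continuous f}.
    move=> r0; have [_ h2 h3] := cU _ _ t01' r0.
    have k2 : {for r, continuous (fun r => Ut (1 - t) r)}.
      by apply: (@continuous_along _ Ut (fun=> 1 - t) id); [exact: cvg_cst|exact: cvg_id|].
    have k3 : {for r, continuous (fun r => Ur (1 - t) r)}.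
      by apply: (@continuous_along _ Ur (fun=> 1 - t) id); [exact: cvg_cst|exact: cvg_id|].
    apply: cvgM; last exact: exprn_continuous.
    exact: cvgD (cvgM k3 k3) (cvgM k2 k2).
  have [||E [_ dE]] := @primitive_exists R f (r1 / 2) (r2 + 1).
  - lra.
  - by move=> r /andP[rr _]; apply: cf; lra.
  have dE' (r : R) : r1 <= r <= r2 -> is_derive r 1 E (f r).
    by move=> /andP[rr1 rr2]; apply: dE; apply/andP; split; lra.
  have hE := HE _ E r1 r2 t01' r10 r12 dE'.
  (* Hardy: [r U^2 <= (r^2 U^2)' + r^3 U_r^2]. *)
  pose F r := 4 * E r + 9 / 4 * (U (1 - t) r ^+ 2 * r ^+ 2).
  have hF : `|H r2 - H r1| <= F r2 - F r1.
    apply: (@deriv_comparison R H F _ (fun r => 4 * f r + 9 / 4 *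
      (2 * U (1 - t) r * Ur (1 - t) r * r ^+ 2 + U (1 - t) r ^+ 2 * (2 * r))) r1 r2 r12 dH)
      => r rr; have /andP[rr1 rr2] := rr; have r0 : 0 < r by lra.
      have dU := (derive_affine_id HU t01' r0).2.
      refine (deriv_eq (derivD (derivM (derivC 4 r) (dE' r rr)) (derivM (derivC (9 / 4) r)
        (derivM (derivX 1 dU) (derivX 1 (derivI r))))) _).
      by ring.
    rewrite ger0_norm; last by rewrite addr_ge0 ?sqr_ge0.
    rewrite /char_a /char_b char_time_slice char_radius_slice /f.
    have Er : r = Num.sqrt r ^+ 2 by rewrite sqr_sqrtr// ltW.
    move: (U (1 - t) r) (Ut (1 - t) r) (Ur (1 - t) r) => v vt vr.
    have w0 : 0 < Num.sqrt r by rewrite sqrtr_gt0.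
    have aux (w : R) : r = w ^+ 2 ->
      (- (1 / 2) * (w ^+ 3 * (vt + vr) + 3 / 2 * (w * v))) ^+ 2 +
      (- (1 / 2) * (w ^+ 3 * (vt - vr) - 3 / 2 * (w * v))) ^+ 2 =
      (r ^+ 3 * vt ^+ 2 + r ^+ 3 * vr ^+ 2 + 3 * r ^+ 2 * vr * v + 9 / 4 * r * v ^+ 2) / 2.
      by move=> ->; field.
    rewrite (aux _ Er) -subr_ge0.
    have -> : 4 * ((vr ^+ 2 + vt ^+ 2) * r ^+ 3) +
      9 / 4 * (2 * v * vr * r ^+ 2 + v ^+ 2 * (2 * r)) -
      (r ^+ 3 * vt ^+ 2 + r ^+ 3 * vr ^+ 2 + 3 * r ^+ 2 * vr * v + 9 / 4 * r * v ^+ 2) / 2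
      = r * (7 / 2 * (r * vt) ^+ 2 + 7 / 2 * (r * vr) ^+ 2 + 3 * (r * vr) * v + 27 / 8 * v ^+ 2).
      by field.
    rewrite mulr_ge0 ?(ltW r0)//.
    have := sqr_ge0 (r * vt); have := sqr_ge0 (r * vr + v); have := sqr_ge0 (r * vr); have := sqr_ge0 v.
    nra.
  have hU : U (1 - t) r2 ^+ 2 * r2 ^+ 2 <= K ^+ 2.
    have r20 : 0 < r2 by lra.
    have Hk := HK _ _ t01' r20.
    rewrite -exprMn -[in leLHS]real_normK ?num_real// normrM (gtr0_norm r20).
    by rewrite ler_pXn2r ?nnegrE ?mulr_ge0 ?(ltW r20)//; lra.
  have hU1 : 0 <= U (1 - t) r1 ^+ 2 * r1 ^+ 2 by rewrite mulr_ge0 ?sqr_ge0.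
  have := ler_norm (H r2 - H r1); rewrite /F in hF; lra.
Qed.

End CharacteristicProfile.

(** * Back to the solution *)

Lemma eq_radial_int {R : realType} (f g : R -> R) :
  (forall r : R, 0 < r -> f r = g r) -> radial_int f = radial_int g.
Proof.
move=> fg; apply: eq_integral => r; rewrite inE/= in_itv/= andbT => r0.
by rewrite fg.
Qed.

Lemma cvg0_squeeze {R : realType} (F : set_system R) {FF : Filter F} (f : R -> \bar R) :
  (forall eps : R, 0 < eps -> \forall t \near F, (0 <= f t <= eps%:E)%E) ->
  f t @[t --> F] --> 0%E.
Proof.
move=> H; apply/fine_cvgP; split.
  apply: filterS (H 1 ltr01) => t /andP[f0 f1].
  by rewrite ge0_fin_numE//; apply: le_lt_trans f1 _; rewrite ltry.
apply/cvgrPdist_le => eps eps0; apply: filterS (H _ eps0) => t /andP[f0 f1].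
have ff : f t \is a fin_num by rewrite ge0_fin_numE//; apply: le_lt_trans f1 _; rewrite ltry.
by rewrite sub0r normrN ger0_norm ?fine_ge0// -lee_fin fineK.
Qed.

Theorem theorem3p1 (R : realType) (lambda : R)
    (hlambda0 : 0 < lambda) (hlambda1 : lambda < 1)
    (u : R -> R -> R)
    (hu : smooth_radial_solution `[0, 1[ u)
    (hbound : (ereal_sup [set H_norm (u t) (dt u t) | t in `[0%R, 1%R[%classic] < +oo)%E) :
  (\int[@lebesgue_measure R]_(r in `[(lambda * (1 - t))%R, (1 - t)%R])
      ((dt u t r ^+ 2 + dr u t r ^+ 2 + u t r ^+ 2 / r ^+ 2) * r ^+ 3)%:E)%E
    @[t --> 1^'-] --> 0%E.
Proof.
have [hs hH _ _ heq] := hu.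
have J01 (t : R) : 0 < t < 1 -> `[0, 1[%classic t.
  by move=> /andP[t0 t1]; rewrite /= in_itv/= (ltW t0) t1.
have [U [Ut [Ur [Utt [Utr [Urr [HU HUt HUr cU eU]]]]]]] := profile_regularity J01 hs.
have [M M0 HM] := energy_uniform hbound.
have cUt (t r : R) : 0 < t < 1 -> 0 < r -> {for r, continuous (Ut t)}.
  move=> t01 r0; have [_ h _] := cU t r t01 r0.
  by apply: (@continuous_along _ Ut (fun=> t) id); [exact: cvg_cst|exact: cvg_id|].
have cUr (t r : R) : 0 < t < 1 -> 0 < r -> {for r, continuous (Ur t)}.
  move=> t01 r0; have [_ _ h] := cU t r t01 r0.
  by apply: (@continuous_along _ Ur (fun=> t) id); [exact: cvg_cst|exact: cvg_id|].
have cr3 (r : R) : {for r, continuous (fun r : R => r ^+ 3)} by exact: exprn_continuous.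
have cE (t r : R) : 0 < t < 1 -> 0 < r ->
    {for r, continuous (fun r => (Ur t r ^+ 2 + Ut t r ^+ 2) * r ^+ 3)}.
  move=> t01 r0; apply: cvgM; last exact: cr3.
  have kr := cUr t r t01 r0; have kt := cUt t r t01 r0.
  exact: cvgD (cvgM kr kr) (cvgM kt kt).
have HE (t : R) (E : R -> R) (r1 r2 : R) : 0 < t < 1 -> 0 < r1 -> r1 <= r2 ->
    (forall r : R, r1 <= r <= r2 -> is_derive r 1 E ((Ur t r ^+ 2 + Ut t r ^+ 2) * r ^+ 3)) ->
    E r2 - E r1 <= M.
  move=> t01 r10 r12 dE.
  apply: (primitive_le_integral _ _ _ r10 r12 dE).
  - by move=> r r0; rewrite mulr_ge0 ?addr_ge0 ?sqr_ge0// exprn_ge0// ltW.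
  - by move=> r r0; exact: cE.
  - have := HM t (J01 t t01).
    rewrite (@eq_radial_int R _ (fun r => Ur t r ^+ 2 + Ut t r ^+ 2))// => r r0.
    by have [_ -> -> _ _] := eU t r t01 r0.
have HK (t r : R) : 0 < t < 1 -> 0 < r -> `|U t r| * r <= M + 1.
  move=> t01; move: r; apply: (@radial_decay R (U t) (Ur t) M M0).
  - by move=> s s0; exact: (derive_affine_id HU t01 s0).2.
  - by move=> s s0; exact: cUr.
  (* The gradient part alone is dominated by a primitive of the full energy density. *)
  - move=> E r1 r2 r10 r12 dE.
    have [||E2 [_ dE2]] := @primitive_exists R (fun r => (Ur t r ^+ 2 + Ut t r ^+ 2) * r ^+ 3) (r1 / 2) (r2 + 1).
    + lra.
    + by move=> x /andP[xr _]; apply: cE => //; lra.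
    have dE2' (r : R) : r1 <= r <= r2 -> is_derive r 1 E2 ((Ur t r ^+ 2 + Ut t r ^+ 2) * r ^+ 3).
      by move=> /andP[rr1 rr2]; apply: dE2; apply/andP; split; lra.
    apply: le_trans (HE t E2 r1 r2 t01 r10 r12 dE2'); apply: le_trans (ler_norm _) _.
    apply: (deriv_comparison r12 dE dE2') => r /andP[rr _].
    have r3 : 0 <= r ^+ 3 by rewrite exprn_ge0//; lra.
    rewrite ger0_norm; last exact: mulr_ge0 (sqr_ge0 _) r3.
    by apply: ler_wpM2r => //; rewrite lerDl sqr_ge0.
  - have [_] := hH t (J01 t t01).
    rewrite (@eq_radial_int R _ (fun r => U t r ^+ 4))// => s s0.
    by have [-> _ _ _ _] := eU t s t01 s0.
have heqU (t r : R) : 0 < t < 1 -> 0 < r ->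
    Utt t r - Urr t r - 3 / r * Ur t r - U t r ^+ 3 = 0.
  move=> t01 r0; have := heq t r (J01 t t01) r0.
  by have [-> _ -> -> ->] := eU t r t01 r0.
have K1 : 1 <= M + 1 by rewrite lerDr.
have cw := char_wave_profile M0 K1 HU HUt HUr cU heqU HK HE.
apply: cvg0_squeeze => eps eps0.
(* The 8 is the constant lost when the density of [u] is compared with that of [V]. *)
have [t0 t00 small] := sector_energy_small cw hlambda0 hlambda1 (divr_gt0 eps0 (ltr0Sn R 7)).
have near0 : \forall t \near (1 : R)^'-, 0 < t < 1 /\ 1 - t < t0.
  near=> t; split.
    apply/andP; split; near: t; [exact: nbhs_left_gt|exact: nbhs_left_lt].
  have : 1 - t0 < t by near: t; apply: nbhs_left_gt; rewrite gtrBl.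
  lra.
apply: filterS near0 => t [t01 tt0].
have s0 : 0 < 1 - t by case/andP: t01 => *; lra.
have l0 : 0 < lambda * (1 - t) by rewrite mulr_gt0.
have l1 : lambda * (1 - t) < 1 - t by rewrite gtr_pMl.
pose f r := (Ut t r ^+ 2 + Ur t r ^+ 2 + U t r ^+ 2 / r ^+ 2) * r ^+ 3.
have cf (r : R) : 0 < r -> {for r, continuous f}.
  move=> r0; have kr := cUr t r t01 r0; have kt := cUt t r t01 r0.
  have ku := deriv_cts (derive_affine_id HU t01 r0).2.
  have ci : {for r, continuous (fun r : R => (r ^+ 2)^-1)}.
    apply: cvgV; first by rewrite expf_neq0// gt_eqF.
    exact: exprn_continuous.
  apply: cvgM; last exact: cr3.
  exact: cvgD (cvgD (cvgM kt kt) (cvgM kr kr)) (cvgM (cvgM ku ku) ci).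
have -> : (\int[@lebesgue_measure R]_(r in `[(lambda * (1 - t))%R, (1 - t)%R])
      ((dt u t r ^+ 2 + dr u t r ^+ 2 + u t r ^+ 2 / r ^+ 2) * r ^+ 3)%:E)%E =
    (\int[@lebesgue_measure R]_(r in `[(lambda * (1 - t))%R, (1 - t)%R]) (f r)%:E)%E.
  apply: eq_integral => r; rewrite inE/= in_itv/= => /andP[r1 _].
  have [-> -> -> _ _] := eU t r t01 (lt_le_trans l0 r1).
  by [].
have f0 (r : R) : 0 < r -> 0 <= f r.
  move=> r0; rewrite mulr_ge0 ?exprn_ge0 ?(ltW r0)// !addr_ge0 ?sqr_ge0//.
  by rewrite divr_ge0 ?sqr_ge0.
apply/andP; split.
  apply: integral_ge0 => r /=; rewrite in_itv/= => /andP[r1 _].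
  by rewrite lee_fin f0// (lt_le_trans l0).
have [||N [_ dN]] := @primitive_exists R f (lambda * (1 - t) / 2) 2.
- lra.
- by move=> r /andP[r1 _]; apply: cf; lra.
have dN' (r : R) : lambda * (1 - t) <= r <= 1 - t -> is_derive r 1 N (f r).
  by move=> /andP[r1 r2]; apply: dN; case/andP: t01 => *; apply/andP; split; lra.
rewrite (integral_primitive l1 _ dN'); last first.
  by move=> r /andP[r1 _]; apply: cf; exact: lt_le_trans r1.
rewrite lee_fin.
pose a := char_a U Ut Ur; pose b := char_b U Ut Ur; pose V := char_V U.
pose h r := a (1 - t - r) (1 - t + r) ^+ 2 + b (1 - t - r) (1 - t + r) ^+ 2 +
  (V (1 - t - r) (1 - t + r) / r) ^+ 2.
have s01 : 0 < 1 - t < 1 by case/andP: t01 => *; apply/andP; split; lra.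
have ch (r : R) : 0 < r -> {for r, continuous h}.
  move=> r0; have h1 := slice_density_continuous cw s01 r0.
  have h2 := deriv_cts (cw_Vr cw s01 r0).
  have ci : {for r, continuous (fun r : R => r^-1)}.
    by apply: cvgV; [rewrite gt_eqF | exact: cvg_id].
  have h3 : {for r, continuous (fun r => char_V U (1 - t - r) (1 - t + r) / r)}.
    by apply: cvgM; [exact: h2 | exact: ci].
  rewrite /h /a /b /V; apply: cvgD; first exact: h1.
  by apply: cvgM; exact: h3.
have [||F [_ dF]] := @primitive_exists R h (lambda * (1 - t) / 2) 2.
- lra.
- by move=> r /andP[r1 _]; apply: ch; lra.
have dF' (r : R) : lambda * (1 - t) <= r <= 1 - t -> is_derive r 1 F (h r).
  by move=> /andP[r1 r2]; apply: dF; case/andP: t01 => *; apply/andP; split; lra.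
have hF := small (1 - t) F s0 tt0 dF'.
(* [V_r] contains [3 / 2 r^(1/2) u] besides [r^(3/2) u_r]; the term [(V / r)^2] in [h], which equals
   [r u^2], is what allows [u_r] to be recovered. *)
have : `|N (1 - t) - N (lambda * (1 - t))| <= 8 * F (1 - t) - 8 * F (lambda * (1 - t)).
  apply: (@deriv_comparison R N (fun r => 8 * F r) f (fun r => 8 * h r) _ _ (ltW l1) dN') => r rr.
    by refine (deriv_eq (derivM (derivC 8 r) (dF' r rr)) _); rewrite mul0r add0r.
  have r0 : 0 < r by case/andP: rr => r1 _; exact: lt_le_trans r1.
  rewrite ger0_norm ?f0//.
  rewrite /h /f /a /b /V /char_a /char_b /char_V char_time_slice char_radius_slice subKr.
  have Er : r = Num.sqrt r ^+ 2 by rewrite sqr_sqrtr// ltW.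
  have w0 : 0 < Num.sqrt r by rewrite sqrtr_gt0.
  suff aux (w v vt vr : R) : 0 < w -> r = w ^+ 2 ->
      (vt ^+ 2 + vr ^+ 2 + v ^+ 2 / r ^+ 2) * r ^+ 3 <=
      8 * ((- (1 / 2) * (w ^+ 3 * (vt + vr) + 3 / 2 * (w * v))) ^+ 2 +
        (- (1 / 2) * (w ^+ 3 * (vt - vr) - 3 / 2 * (w * v))) ^+ 2 + (w ^+ 3 * v / r) ^+ 2).
    exact: aux.
  move=> wpos ->.
  have -> : (vt ^+ 2 + vr ^+ 2 + v ^+ 2 / (w ^+ 2) ^+ 2) * (w ^+ 2) ^+ 3 =
     (w ^+ 3 * vt) ^+ 2 + (w ^+ 3 * vr) ^+ 2 + (w * v) ^+ 2.
    by field; rewrite gt_eqF.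
  have -> : w ^+ 3 * v / w ^+ 2 = w * v by field; rewrite gt_eqF.
  rewrite (mulrBr (w ^+ 3)) (mulrDr (w ^+ 3)).
  move: (w ^+ 3 * vt) (w ^+ 3 * vr) (w * v) => A B z.
  rewrite -subr_ge0.
  have -> : 8 * ((- (1 / 2) * (A + B + 3 / 2 * z)) ^+ 2 +
      (- (1 / 2) * (A - B - 3 / 2 * z)) ^+ 2 + z ^+ 2) - (A ^+ 2 + B ^+ 2 + z ^+ 2)
    = 3 * A ^+ 2 + 3 * (B + 2 * z) ^+ 2 + 4 * z ^+ 2 by field.
  have := sqr_ge0 A; have := sqr_ge0 (B + 2 * z); have := sqr_ge0 z; lra.
have := ler_norm (N (1 - t) - N (lambda * (1 - t))); lra.
Unshelve. all: by end_near. Qed.
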